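(* Let $T_{R_i}$, $i=1,\ldots,k$, denote independent quantile clocks such that, for each fixed $t$, $T_{R_i}(t)\stackrel{d}{=}\zeta_i(t)$ for independent subordinators $\zeta_i$ with corresponding Laplace exponents $\psi_{\zeta_i}(\omega)$, $i=1,\ldots,k$. Then the composition $\widehat T_k=(\widehat T_k(t)=T_{R_1}\circ\cdots\circ T_{R_k}(t):t\ge 0)$ is an increasing process such that for each fixed $t$, $$\widehat T_k(t)\stackrel{d}{=}\widehat\zeta_k(t)=\zeta_1\circ\cdots\circ\zeta_k(t),$$ where $\widehat\zeta_k$ is a subordinator with Laplace exponent $$\psi_{\zeta_k}\circ\cdots\circ\psi_{\zeta_1}(\omega).$$ If each $T_{R_i}$ is a continuous process, then $\widehat T_k$ is a continuous process.
   Context: A subordinator $\zeta$ is an increasing right-continuous process started at $0$ with stationary independent increments, zero drift, and $\mathbb{E}[e^{-\omega\zeta(t)}]=e^{-t\psi_\zeta(\omega)}$, $\omega>0$; $\psi_\zeta$ is its Laplace exponent. Quantile clock with parameters $(R,L)$: $R$ is a positive random variable with continuous strictly increasing (on its support) c.d.f. $F_R$ and $\mathbb{E}[R]<\infty$, $Q_R(u)=\inf\{t:F_R(t)\ge u\}$, $L$ is an infinite activity subordinator (infinite total Lévy mass), and $T_R(t)=\int_0^tQ_R((1-s/t)_+)L(ds)$, $t\ge0$, $(a)_+=\max(0,a)$. Composition: $T_{R_1}\circ T_{R_2}(t)=T_{R_1}(T_{R_2}(t))$. The clock $T_{R_i}$ has its own parameters $(R_i,L_i)$, with independent $L_i$.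 *)

(* Defs.v *)
From HB Require Import structures.
From mathcomp Require Import all_boot all_order all_algebra.
From mathcomp Require Import all_classical all_reals all_analysis.
From mathcomp Require Import measurable_realfun.

Set Implicit Arguments.
Unset Strict Implicit.
Unset Printing Implicit Defensive.

Import Order.TTheory GRing.Theory Num.Theory.
Import numFieldNormedType.Exports.

Local Open Scope classical_set_scope.
Local Open Scope ring_scope.

(* Processes are functions X : R -> T -> R (or \bar R) of time and outcome;
   only the times t >= 0 are meaningful. *)

Definition indep_rvs d (T : measurableType d) (R : realType)
    (P : probability T R) (I : finType) (X : I -> T -> R) : Prop :=
  forall B : I -> set R, (forall i, measurable (B i)) ->
    P (\bigcap_(i in [set: I]) (X i @^-1` B i)) =
    (\prod_(i : I) P (X i @^-1` B i))%E.

Definition process_sigma d (T : measurableType d) (R : realType)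
    (X : R -> T -> R) : set (set T) :=
  <<s [set A | exists t B, [/\ 0 <= t, measurable B & A = X t @^-1` B]] >>.

(* Subfamilies are covered by taking A i := setT. *)
Definition indep_processes d (T : measurableType d) (R : realType)
    (P : probability T R) (I : finType) (X : I -> R -> T -> R) : Prop :=
  forall A : I -> set T, (forall i, process_sigma (X i) (A i)) ->
    P (\bigcap_(i in [set: I]) A i) = (\prod_(i : I) P (A i))%E.

Definition eq_in_law d1 d2 d' (T1 : measurableType d1) (T2 : measurableType d2)
    (V : measurableType d') (R : realType)
    (P1 : probability T1 R) (P2 : probability T2 R)
    (X : T1 -> V) (Y : T2 -> V) : Prop :=
  [/\ measurable_fun setT X, measurable_fun setT Y &
      forall B : set V, measurable B -> P1 (X @^-1` B) = P2 (Y @^-1` B)].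

Definition increasing_process d (V : porderType d) (R : realType) (T : Type)
    (X : R -> T -> V) : Prop :=
  forall w s t, 0 <= s -> s <= t -> (X s w <= X t w)%O.

Definition levy_measure (R : realType) (nu : {measure set R -> \bar R}) : Prop :=
  nu [set` `]-oo, 0%R]] = 0%E /\
  (\int[nu]_(x in `]0%R, +oo[) (Num.min 1 x)%:E < +oo)%E.

(* The Levy-Khintchine formula without linear term: nu is the Levy measure of a
   subordinator with Laplace exponent psi and zero drift. *)
Definition driftless_exponent (R : realType) (nu : {measure set R -> \bar R})
    (psi : R -> R) : Prop :=
  levy_measure nu /\
  forall omega, 0 < omega ->
    (psi omega)%:E =
    (\int[nu]_(x in `]0%R, +oo[) (1 - expR (- (omega * x)))%:E)%E.

Record subordinator d (T : measurableType d) (R : realType)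
    (P : probability T R) (X : R -> T -> R) (psi : R -> R) : Prop := {
  subordinator_measurable : forall t, 0 <= t -> measurable_fun setT (X t) ;
  subordinator_start : forall w, X 0 w = 0 ;
  subordinator_increasing : increasing_process X ;
  subordinator_right_continuous :
    forall w t, 0 <= t -> X ^~ w @ t^'+ --> X t w ;
  subordinator_stationary : forall s t, 0 <= s -> s <= t ->
    eq_in_law P P (fun w => X t w - X s w) (X (t - s)) ;
  subordinator_indep_increments : forall (n : nat) (t : nat -> R),
    0 <= t 0%N -> {homo t : i j / (i <= j)%N >-> i <= j} ->
    indep_rvs P (fun (i : 'I_n) w => X (t i.+1) w - X (t i) w) ;
  subordinator_laplace : forall t omega, 0 <= t -> 0 < omega ->
    'E_P[fun w => expR (- (omega * X t w))]%E = (expR (- (t * psi omega)))%:E ;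
  subordinator_zero_drift :
    exists nu : {measure set R -> \bar R}, driftless_exponent nu psi }.

Definition infinite_activity_subordinator d (T : measurableType d)
    (R : realType) (P : probability T R) (L : R -> T -> R) : Prop :=
  exists psi, subordinator P L psi /\
    exists nu : {measure set R -> \bar R},
      driftless_exponent nu psi /\ nu [set` `]0%R, +oo[] = +oo%E.

Definition law_support d (T : measurableType d) (R : realType)
    (P : probability T R) (X : {RV P >-> R}) : set R :=
  [set x | forall e, 0 < e -> (0 < distribution P X (ball x e))%E].

Record clock_variable d (T : measurableType d) (R : realType)
    (P : probability T R) (X : {RV P >-> R}) : Prop := {
  clock_variable_pos : P [set w | 0 < X w] = 1%E ;
  clock_variable_cdf_continuous : continuous (cdf X) ;
  clock_variable_cdf_increasing : forall x y,
    law_support X x -> law_support X y -> x < y -> (cdf X x < cdf X y)%E ;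
  clock_variable_integrable : ('E_P[X] < +oo)%E }.

(* The infimum is over t >= 0, the range of a positive X: this matters only for
   u <= 0, where it gives 0. The value at u = 1 is +oo if X is unbounded. *)
Definition quantile d (T : measurableType d) (R : realType)
    (P : probability T R) (X : {RV P >-> R}) (u : R) : \bar R :=
  ereal_inf [set t%:E | t in [set t : R | 0 <= t /\ (u%:E <= cdf X t)%E]].

(* L w is the path of the subordinator, extended to a nondecreasing
   right-continuous function on the whole line; as L w 0 = 0 there is no mass
   at 0, and the integral over ]0, t] does not depend on the extension.
   The integral is a priori extended-valued. *)
Definition quantile_clock d (T : measurableType d) (R : realType)
    (P : probability T R) (X : {RV P >-> R}) (L : T -> cumulative R R)
    (t : R) (w : T) : \bar R :=
  (\int[lebesgue_stieltjes_measure (L w)]_(s in `]0%R, t])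
     quantile X (Num.max 0 (1 - (s : R) / t))%R)%E.

Definition comp_process (R : realType) (T : Type) (X Y : R -> T -> R) :
    R -> T -> R :=
  fun t w => X (Y t w) w.

(* Composition of [0, +oo]-valued processes, each sent to +oo at time +oo. *)
Definition comp_eprocess (R : realType) (T : Type) (X Y : R -> T -> \bar R) :
    R -> T -> \bar R :=
  fun t w => if Y t w is r%:E then X r w else +oo%E.

(* The iterated operators associate to the right: X_0 o (X_1 o ( ... o id)). *)
Definition comp_processes (R : realType) (T : Type) (k : nat)
    (X : 'I_k -> R -> T -> R) : R -> T -> R :=
  \big[@comp_process R T / fun t _ => t]_(i < k) X i.

Definition comp_eprocesses (R : realType) (T : Type) (k : nat)
    (X : 'I_k -> R -> T -> \bar R) : R -> T -> \bar R :=
  \big[@comp_eprocess R T / fun t _ => t%:E]_(i < k) X i.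

(* Reversed order: psi_(k-1) o ... o psi_0. *)
Definition comp_exponents (R : realType) (k : nat) (psi : 'I_k -> R -> R) :
    R -> R :=
  \big[(fun f g => g \o f) / idfun]_(i < k) psi i.

Definition continuous_process d (T : measurableType d) (R : realType)
    (P : probability T R) (X : R -> T -> \bar R) : Prop :=
  {ae P, forall w, {within `[0, +oo[, continuous (X ^~ w)}}.

(* Main.v *)
Require Import Defs.
From HB Require Import structures.
From mathcomp Require Import all_boot all_order all_algebra.
From mathcomp Require Import all_classical all_reals all_analysis.
From mathcomp Require Import measurable_realfun.
From mathcomp Require Import ring lra.

Set Implicit Arguments.
Unset Strict Implicit.
Unset Printing Implicit Defensive.

Import Order.TTheory GRing.Theory Num.Theory.
Import numFieldNormedType.Exports.

Local Open Scope classical_set_scope.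
Local Open Scope ring_scope.

(** A process [X] run at an independent random time [Y t] can be studied by
    freezing [Y t] at a constant [y], computing with [X y] alone, and averaging
    over the law of [Y t] ([integral_diagonal]). The whole statement rests on
    this conditioning, iterated along the composition.

    Law. The law of [X (Y t)] is the average over [y] of the law of [X y]: it
    depends on the one-dimensional laws of [X] and on the law of [Y t] only
    ([eq_in_law_comp_eprocess]). As each clock has the one-dimensional laws of the
    corresponding subordinator, an induction on the number of processes
    identifies the law of the composed clocks with that of the composed
    subordinators. Substituting a random time is legitimate because monotone
    paths that are continuous on one side are jointly measurable in time and
    outcome: subordinators are right-continuous, and a clock is always
    left-continuous, by monotone convergence and left continuity of the quantile
    ([quantile_clock_left_continuous]). The clocks are independent because each
    is a functional of its own driving process
    ([path_measurable_quantile_clock]).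

    Subordinator. For independent subordinators [X] and [Y], freezing [Y] turns
    the increments of [X (Y t)] into increments of [X] at deterministic times;
    their stationarity and independence, and then those of the increments of
    [Y], give the same for the composition ([subordinator_comp]). Freezing in
    the Laplace transform yields
    [E exp (- omega X (Y t)) = E exp (- psiX omega * Y t)
       = exp (- t psiY (psiX omega))].
    Absence of drift is witnessed by an explicit Levy measure, the mixture of the
    laws of [X s] over the Levy measure of [Y]
    ([driftless_exponent_comp]). Exponents are only specified at positive
    frequencies, so [psiX omega] has to be positive; this holds because a clock
    with infinite activity does not vanish ([clock_exponent_gt0]).

    Paths. Monotonicity is preserved by composition. A clock is almost surely
    finite at each integer, hence at all times, so that almost surely the
    composition is one of continuous real functions
    ([continuous_comp_eprocesses]). *)

(** * Independence and freezing *)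

(** The whole space and stability under intersection make the rectangles
    [A `*` B] with [C1 A] and [C2 B] a pi-system that generates the product of
    the two sigma-algebras, so that independence on [C1] and [C2] determines
    joint laws. *)
Record independent_pi_systems d (T : measurableType d) (R : realType)
    (P : probability T R) (C1 C2 : set (set T)) : Prop := {
  pi_system1_measurable : C1 `<=` measurable ;
  pi_system2_measurable : C2 `<=` measurable ;
  pi_system1_setI : setI_closed C1 ;
  pi_system2_setI : setI_closed C2 ;
  pi_system1_setT : C1 setT ;
  pi_system2_setT : C2 setT ;
  pi_systems_indep : forall A B, C1 A -> C2 B ->
    P (A `&` B) = (P A * P B)%E }.

Lemma g_sigma_measurable d (T : measurableType d) (C : set (set T)) :
  C `<=` measurable -> forall A : set T, <<s C >> A -> measurable A.
Proof.
by move=> mC; exact: (smallest_sub (@sigma_algebra_measurable _ T) mC).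
Qed.

Lemma measurable_idfun_g_sigma d (T : measurableType d) (C : set (set T)) :
  C `<=` measurable ->
  measurable_fun [set: T] (idfun : T -> g_sigma_algebraType C).
Proof. by move=> mC _ A mA; rewrite setTI; exact: (g_sigma_measurable mC mA). Qed.

(** Each side of a generating rectangle is freed by intersecting with full
    strips [A `*` setT] and [setT `*` B]; these are rectangles because both
    systems contain the whole space. *)
Lemma measurable_rectangles (T1 T2 : pointedType) (C1 : set (set T1))
    (C2 : set (set T2)) : C1 setT -> C2 setT ->
  @measurable _ (g_sigma_algebraType C1 * g_sigma_algebraType C2)%type =
  <<s [set A `*` B | A in C1 & B in C2] >>.
Proof.
move=> C1T C2T; rewrite measurable_prod_measurableType.
set G := [set A `*` B | A in C1 & B in C2].
pose TT := g_sigma_algebraType G.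
have mfst : measurable_fun [set: TT] (fst : TT -> g_sigma_algebraType C1).
  apply: (@measurability _ _ TT (g_sigma_algebraType C1) setT fst C1) => //.
  move=> _ [A C1A <-]; apply: sub_sigma_algebra.
  by exists A => //; exists setT => //; rewrite setTI setXT.
have msnd : measurable_fun [set: TT] (snd : TT -> g_sigma_algebraType C2).
  apply: (@measurability _ _ TT (g_sigma_algebraType C2) setT snd C2) => //.
  move=> _ [A C2A <-]; apply: sub_sigma_algebra.
  by exists setT => //; exists A => //; rewrite setTI setTX.
rewrite eqEsubset; split; last first.
  apply: smallest_sub; first exact: smallest_sigma_algebra.
  move=> _ [A C1A [B C2B <-]]; apply: sub_sigma_algebra.
  exists A; first exact: sub_sigma_algebra.
  by exists B => //; exact: sub_sigma_algebra.
apply: smallest_sub; first exact: smallest_sigma_algebra.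
move=> _ [A mA [B mB <-]]; rewrite (_ : A `*` B = fst @^-1` A `&` snd @^-1` B)//.
apply: (@measurableI _ TT).
  by rewrite -[X in measurable X]setTI; exact: mfst.
by rewrite -[X in measurable X]setTI; exact: msnd.
Qed.

Section integral_diagonal.
Context d (T : measurableType d) (R : realType) (P : probability T R).
Variables (C1 C2 : set (set T)) (CC : independent_pi_systems P C1 C2).
Local Notation T1 := (g_sigma_algebraType C1).
Local Notation T2 := (g_sigma_algebraType C2).

(** Freezing principle: [w |-> (w, w)] sends [P] to a measure that agrees with
    the product of the restrictions of [P] on rectangles, hence everywhere, and
    Tonelli's theorem gives the iterated integral. An independent argument can
    thus be treated as a constant and averaged afterwards; every use of
    independence below goes through this identity. *)
Lemma integral_diagonal (f : T1 * T2 -> \bar R) :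
  measurable_fun setT f -> (forall x, 0 <= f x)%E ->
  (\int[P]_w f (w, w) = \int[P]_w \int[P]_w' f (w, w'))%E.
Proof.
move=> mf f0.
have mid1 := measurable_idfun_g_sigma (pi_system1_measurable CC).
have mid2 := measurable_idfun_g_sigma (pi_system2_measurable CC).
have mdiag : measurable_fun [set: T] ((fun w => (w, w)) : T -> T1 * T2).
  exact: (measurable_fun_pair mid1 mid2).
pose X1 : {mfun T >-> T1} := mfun_Sub (mem_set mid1).
pose X2 : {mfun T >-> T2} := mfun_Sub (mem_set mid2).
pose X12 : {mfun T >-> (T1 * T2)%type} := mfun_Sub (mem_set mdiag).
pose P1 := distribution P X1; pose P2 := distribution P X2.
have E A : measurable A -> distribution P X12 A = (P1 \x P2)%E A.
  move=> mA.
  refine (@measure_unique _ R (T1 * T2)%type [set A `*` B | A in C1 & B in C2]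
    (fun=> setT) _ _ _ _ (distribution P X12) (P1 \x P2)%E _ _ A mA) => //.
  - exact: measurable_rectangles (pi_system1_setT CC) (pi_system2_setT CC).
  - move=> _ _ [A1 C1A [B1 C2B <-]] [A2 C1A' [B2 C2B' <-]].
    rewrite -setXI; exists (A1 `&` A2); first exact: (pi_system1_setI CC).
    by exists (B1 `&` B2) => //; exact: (pi_system2_setI CC).
  - move=> _; exists setT; first exact: (pi_system1_setT CC).
    by exists setT; [exact: (pi_system2_setT CC)|rewrite setXTT].
  - by rewrite bigcup_const.
  - move=> _ [A1 C1A [B1 C2B <-]].
    transitivity (P1 A1 * P2 B1)%E; first exact: (pi_systems_indep CC).
    by symmetry; apply: product_measure1E; exact: sub_sigma_algebra.
  - move=> _; have : (P (X12 @^-1` setT) < +oo)%E.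
      by rewrite preimage_setT probability_setT ltry.
    exact.
have -> : (\int[P]_w f (w, w) = \int[distribution P X12]_z f z)%E.
  by rewrite ge0_integral_distribution.
rewrite (eq_measure_integral (P1 \x P2)%E); last by move=> A mA _; exact: E.
rewrite fubini_tonelli1//= ge0_integral_distribution//=; last 2 first.
  - exact: measurable_fun_fubini_tonelli_F.
  - by move=> w; apply: integral_ge0.
apply: eq_integral => w _ /=; rewrite /fubini_F ge0_integral_distribution//=.
exact: measurableT_comp.
Qed.

Lemma probability_diagonal (E : set (T1 * T2)) : measurable E ->
  (P [set w | E (w, w)] = \int[P]_w P [set w' | E (w, w')])%E.
Proof.
move=> mE.
have mid1 := measurable_idfun_g_sigma (pi_system1_measurable CC).
have mid2 := measurable_idfun_g_sigma (pi_system2_measurable CC).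
have m1E : measurable_fun [set: T1 * T2] (fun z => (\1_E z)%:E : \bar R).
  exact/measurable_EFinP/measurable_indic.
have := integral_diagonal m1E (fun=> _).
have -> : (\int[P]_w (\1_E (w, w))%:E = P [set w | E (w, w)])%E.
  rewrite -[in RHS](setIT [set w | _]) -integral_indic//.
  rewrite -[X in measurable X]setTI.
  exact: (measurable_fun_pair mid1 mid2).
move=> ->; last by move=> z; rewrite lee_fin.
apply: eq_integral => w _.
rewrite -[in RHS](setIT [set w' | _]) -integral_indic//.
rewrite -[X in measurable X]setTI.
have mw : measurable_fun [set: T] (fun=> w : T1) by exact: measurable_cst.
exact: (measurable_fun_pair mw mid2).
Qed.

End integral_diagonal.

Lemma emeasurable_prod_ord d (T : measurableType d) (R : realType) n
    (g : 'I_n -> T -> \bar R) : (forall i, measurable_fun setT (g i)) ->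
  measurable_fun setT (fun w => \prod_(i < n) g i w)%E.
Proof.
elim: n g => [|n IH] g mg.
  by under eq_fun do rewrite big_ord0; exact: measurable_cst.
under eq_fun do rewrite big_ord_recl.
by apply: emeasurable_funM => //; exact: IH.
Qed.

Lemma indep_rvs_tail d (T : measurableType d) (R : realType)
    (P : probability T R) n (Z : 'I_n.+1 -> T -> R) :
  indep_rvs P Z -> indep_rvs P (fun i => Z (lift ord0 i)).
Proof.
move=> ZI B mB.
have := ZI (fun i => if unlift ord0 i is Some j then B j else setT).
have H i : measurable (if unlift ord0 i is Some j then B j else setT).
  by case: unliftP => [j _|_].
move=> /(_ H); rewrite big_ord_recl unlift_none preimage_setT probability_setT.
rewrite mul1e => E.
transitivity (P (\bigcap_(i in [set: 'I_n.+1])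
    Z i @^-1` (if unlift ord0 i is Some j then B j else setT))).
  congr (P _); apply/seteqP; split => w /= wB i _ /=.
    by case: unliftP => [j ->|//]; exact: wB.
  by have := wB (lift ord0 i) I; rewrite liftK.
by rewrite E; apply: eq_bigr => i _; rewrite liftK.
Qed.

(** Induction on the number of factors: the events of the tail form a pi-system
    independent of that of the first variable, so freezing the tail separates
    the first factor. *)
Lemma expectation_prod_indep d (T : measurableType d) (R : realType)
    (P : probability T R) n (Z : 'I_n -> T -> R) (f : 'I_n -> R -> \bar R) :
  (forall i, measurable_fun setT (Z i)) ->
  (forall i, measurable_fun setT (f i)) -> (forall i x, 0 <= f i x)%E ->
  indep_rvs P Z ->
  (\int[P]_w \prod_(i < n) f i (Z i w) = \prod_(i < n) \int[P]_w f i (Z i w))%E.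
Proof.
elim: n => [|n IH] in Z f *.
  move=> *; rewrite big_ord0; under eq_integral do rewrite big_ord0.
  by rewrite integral_cst// mul1e; exact: probability_setT.
move=> mZ mf f0 ZI.
pose C1 := [set A | exists2 B : 'I_n -> set R, (forall i, measurable (B i)) &
  A = \bigcap_(i in [set: 'I_n]) Z (lift ord0 i) @^-1` B i].
pose C2 := [set A | exists2 B : set R, measurable B & A = Z ord0 @^-1` B].
have mpre i B : measurable B -> measurable (Z i @^-1` B).
  by move=> mB; rewrite -[X in measurable X]setTI; exact: mZ.
have CC : independent_pi_systems P C1 C2.
  split.
  - move=> _ [B mB ->]; apply: fin_bigcap_measurable; first exact: finite_finset.
    by move=> i _; exact: mpre.
  - by move=> _ [B mB ->]; exact: mpre.
  - move=> _ _ [B mB ->] [B' mB' ->]; exists (fun i => B i `&` B' i).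
      by move=> i; exact: measurableI.
    by rewrite -bigcapI.
  - move=> _ _ [B mB ->] [B' mB' ->]; exists (B `&` B') => //.
    exact: measurableI.
  - exists (fun=> setT) => //; apply/seteqP; split => // w _ i _ //.
  - by exists setT.
  - move=> _ _ [B mB ->] [B' mB' ->].
    pose D i := if unlift ord0 i is Some j then B j else B'.
    have mD i : measurable (D i) by rewrite /D; case: unliftP.
    have := ZI D mD; rewrite big_ord_recl {2}/D unlift_none => E.
    rewrite (indep_rvs_tail ZI mB) muleC.
    transitivity (P (\bigcap_(i in [set: 'I_n.+1]) Z i @^-1` D i)).
      congr (P _); apply/seteqP; split => w /=.
        move=> [wB wB'] i _ /=; rewrite /D.
        by case: unliftP => [j ->|->//]; exact: wB.
      move=> wD; split.
        by move=> i _; have := wD (lift ord0 i) I; rewrite /D /= liftK.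
      by have := wD ord0 I; rewrite /D /= unlift_none.
    by rewrite E; congr (_ * _)%E; apply: eq_bigr => i _; rewrite /D liftK.
have mZ0 : measurable_fun [set: g_sigma_algebraType C2] (Z ord0).
  by move=> _ B mB; apply: sub_sigma_algebra; exists B => //; rewrite setTI.
have mZS i : measurable_fun [set: g_sigma_algebraType C1] (Z (lift ord0 i)).
  move=> _ B mB; apply: sub_sigma_algebra.
  exists (fun j => if j == i then B else setT); first by move=> j; case: ifP.
  rewrite setTI; apply/seteqP; split => w /=.
    by move=> wB j _ /=; case: eqP => // ->.
  by move/(_ i I); rewrite /= eqxx.
have mprod : measurable_fun [set: g_sigma_algebraType C1]
    (fun w => \prod_(i < n) f (lift ord0 i) (Z (lift ord0 i) w))%E.
  by apply: emeasurable_prod_ord => i; exact: measurableT_comp (mf _) (mZS i).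
rewrite big_ord_recl.
rewrite -(IH (fun i => Z (lift ord0 i)) (fun i => f (lift ord0 i)))//; last first.
  exact: indep_rvs_tail.
have m0 : measurable_fun [set: g_sigma_algebraType C1 * g_sigma_algebraType C2]
   (fun z => f ord0 (Z ord0 z.2) *
      \prod_(i < n) f (lift ord0 i) (Z (lift ord0 i) z.1))%E.
  apply: emeasurable_funM.
    exact: (measurableT_comp (mf _) (measurableT_comp mZ0 measurable_snd)).
  exact: (measurableT_comp mprod measurable_fst).
under eq_integral do rewrite big_ord_recl.
rewrite (integral_diagonal CC m0)/=; last first.
  by move=> z; rewrite mule_ge0// prode_ge0.
have mZ' i : measurable_fun setT (fun w => f i (Z i w)).
  exact: measurableT_comp (mf i) (mZ i).
have mprod' : measurable_fun setT
    (fun w => \prod_(i < n) f (lift ord0 i) (Z (lift ord0 i) w))%E.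
  by apply: emeasurable_prod_ord.
under eq_integral.
  move=> w _; rewrite ge0_integralZr//; last by rewrite prode_ge0.
  over.
rewrite ge0_integralZl//; first by move=> w _; rewrite prode_ge0.
by apply: integral_ge0.
Qed.

Lemma measurable_fun_g_sigmaS d' (T : pointedType) (V : measurableType d')
    (C D : set (set T)) (f : T -> V) : C `<=` D ->
  measurable_fun [set: g_sigma_algebraType C] f ->
  measurable_fun [set: g_sigma_algebraType D] f.
Proof.
move=> CD mf _ B mB; have := mf measurableT B mB; apply: smallest_sub.
  exact: smallest_sigma_algebra.
by move=> A CA; apply: sub_sigma_algebra; exact: CD.
Qed.

Section process_sigma.
Context d (T : measurableType d) (R : realType).
Implicit Types X : R -> T -> R.

Lemma process_sigma_measurable X :
  (forall t, 0 <= t -> measurable_fun setT (X t)) ->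
  process_sigma X `<=` measurable.
Proof.
move=> mX; apply: g_sigma_measurable => _ [t [B [t0 mB ->]]].
by rewrite -[X in measurable X]setTI; exact: mX.
Qed.

Lemma measurable_process_sigma X t : 0 <= t ->
  measurable_fun [set: g_sigma_algebraType (process_sigma X)] (X t).
Proof.
move=> t0 _ B mB; apply: sub_sigma_algebra; apply: sub_sigma_algebra.
by exists t, B; rewrite setTI.
Qed.

Let process_sigmaT X : process_sigma X setT.
Proof. by rewrite -setC0; apply: sigma_algebraC; exact: sigma_algebra0. Qed.

Let process_sigmaI X A B :
  process_sigma X A -> process_sigma X B -> process_sigma X (A `&` B).
Proof.
move=> XA XB; pose G := [set A | exists t B,
  [/\ 0 <= t, measurable B & A = X t @^-1` B]].
exact: (@measurableI _ (g_sigma_algebraType G)).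
Qed.

(** A generating pi-system, rather than the sigma-algebra itself, of the joint
    information of the processes: on it independence is the product formula. *)
Definition joint_events n (X : 'I_n -> R -> T -> R) : set (set T) :=
  [set A | exists2 B : 'I_n -> set T,
    (forall i, process_sigma (X i) (B i)) & A = \bigcap_(i in [set: 'I_n]) B i].

Lemma process_sigma_joint_events n (X : 'I_n -> R -> T -> R) i :
  process_sigma (X i) `<=` joint_events X.
Proof.
move=> A XA; exists (fun j => if j == i then A else setT).
  by move=> j; case: eqP => // ->.
apply/seteqP; split => w /=.
  by move=> wA j _; case: eqP.
by move/(_ i Logic.I); rewrite eqxx.
Qed.

Let bigcap_lift n (B : 'I_n -> set T) (B0 : set T) :
  \bigcap_(i in [set: 'I_n.+1]) (if unlift ord0 i is Some j then B j else B0) =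
  \bigcap_(i in [set: 'I_n]) B i `&` B0.
Proof.
apply/seteqP; split => w /=.
  move=> wB; split; last by have := wB ord0 Logic.I; rewrite unlift_none.
  by move=> i _; have := wB (lift ord0 i) Logic.I; rewrite liftK.
by move=> [wB wB0] i _; case: unliftP => // j _; exact: wB.
Qed.

Variable P : probability T R.

Lemma indep_processes_tail n (X : 'I_n.+1 -> R -> T -> R) :
  indep_processes P X -> indep_processes P (fun i => X (lift ord0 i)).
Proof.
move=> XI A XA.
pose D i := if unlift ord0 i is Some j then A j else setT.
have XD i : process_sigma (X i) (D i).
  by rewrite /D; case: unliftP => [j ->|->].
have := XI D XD; rewrite bigcap_lift setIT => ->.
rewrite big_ord_recl {1}/D unlift_none probability_setT mul1e.
by apply: eq_bigr => i _; rewrite /D liftK.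
Qed.

Lemma independent_joint_events n (X : 'I_n.+1 -> R -> T -> R) :
  (forall i t, 0 <= t -> measurable_fun setT (X i t)) ->
  indep_processes P X ->
  independent_pi_systems P (joint_events (fun i => X (lift ord0 i)))
    (process_sigma (X ord0)).
Proof.
move=> mX XI; split => //.
- move=> _ [B XB ->]; apply: fin_bigcap_measurable; first exact: finite_finset.
  move=> i _; apply: process_sigma_measurable (XB i) => t; exact: mX.
- by apply: process_sigma_measurable => t; exact: mX.
- move=> _ _ [B XB ->] [B' XB' ->]; exists (fun i => B i `&` B' i).
    by move=> i; exact: process_sigmaI.
  by rewrite -bigcapI.
- by move=> A B; exact: process_sigmaI.
- exists (fun=> setT) => [i|]; first exact: process_sigmaT.
  by apply/seteqP; split.
- move=> _ A [B XB ->] XA.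
  rewrite (indep_processes_tail XI XB) -bigcap_lift XI.
    rewrite big_ord_recl unlift_none muleC; congr (_ * _)%E.
    by apply: eq_bigr => i _; rewrite liftK.
  by move=> i; case: unliftP => [j ->|->].
Qed.

End process_sigma.

(** * Joint measurability of monotone processes *)

(** Clamping real times at 0 makes this a function on all of [\bar R] that can
    be jointly measurable although paths are controlled on nonnegative times
    only; at nonnegative [Y t w] it is the composition of processes. *)
Definition at_etime (R : realType) (T : Type) (X : R -> T -> \bar R)
    (y : \bar R) (w : T) : \bar R :=
  if y is r%:E then X (Num.max 0 r) w else +oo%E.

Section joint_measurability.
Context d (T : measurableType d) (R : realType).
Variable X : R -> T -> \bar R.
Hypothesis mX : forall t, 0 <= t -> measurable_fun setT (X t).
Hypothesis X_incr : increasing_process X.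

Let le_at r s w : r <= s -> (X (Num.max 0 r)%R w <= X (Num.max 0 s)%R w)%E.
Proof.
move=> rs; apply: X_incr; first by rewrite le_max lexx.
by rewrite ge_max !le_max lexx rs orbT.
Qed.

Let mfin : measurable [set z : \bar R * T | z.1 \is a fin_num].
Proof.
by have := emeasurable_fin_num measurableT
  (measurable_fst : measurable_fun setT (fst : \bar R * T -> _)); rewrite setTI.
Qed.

(** For monotone left-continuous paths, [X] exceeds [c] at time [y] exactly when
    it already does so at some rational time before [y]: the superlevel sets are
    countable unions of measurable rectangles. *)
Lemma left_continuous_measurable_at_etime :
  (forall w t c, 0 < t -> (c < X t w)%E ->
    exists2 s, 0 <= s < t & (c < X s w)%E) ->
  measurable_fun setT (fun z : \bar R * T => at_etime X z.1 z.2).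
Proof.
move=> X_left; apply: (measurability _ (ErealGenOInfty.measurableE R)) => //.
move=> /= _ [_ [c ->] <-]; rewrite preimage_itvoy setTI.
rewrite [X in measurable X](_ : _ =
  ~` [set z | z.1 \is a fin_num] `|`
  [set z | z.1 \is a fin_num] `&` \bigcup_(q : rat)
  ([set y | (ratr q)%:E < y] `*`
    [set w | c%:E < X (Num.max 0 (ratr q))%R w])%E).
  apply: measurableU; first exact: measurableC.
  apply: measurableI => //; apply: bigcupT_measurable_rat => q.
  apply: measurableX.
    by rewrite -set_itvoy; exact: emeasurable_itv.
  rewrite -[X in measurable X]setTI; apply: emeasurable_fun_o_infty => //.
  by apply: mX; rewrite le_max lexx.
apply/seteqP; split => -[[r| |] w] /=.
- move=> cX; right; split => //.
  have [r0|r0] := leP r 0.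
    have /rat_in_itvoo[q] : r - 1 < r by rewrite ltrBlDr ltrDl.
    rewrite in_itv/= => /andP[_ qr]; exists q => //; split=> //=.
    rewrite max_l ?(le_trans (ltW qr))//.
    by move: cX; rewrite max_l.
  move: cX; rewrite max_r ?(ltW r0)// => /(X_left _ _ _ r0)[s /andP[s0 sr] cX].
  have /rat_in_itvoo[q] := sr; rewrite in_itv/= => /andP[sq qr].
  exists q => //; split=> //=.
  by rewrite (lt_le_trans cX)//; have := le_at w (ltW sq); rewrite max_r.
- by left.
- by left.
- move=> [//|[_ [q _ [/= qr cX]]]]; rewrite (lt_le_trans cX)// le_at//.
  by rewrite ltW// -lte_fin.
- by rewrite ltry.
- by rewrite ltry.
Qed.

(** The mirror image: [X] is below [c] at time [y] exactly when it still is at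
    some rational time after [y]. *)
Lemma right_continuous_measurable_at_etime :
  (forall w t c, 0 <= t -> (X t w < c)%E ->
    exists2 s, t < s & (X s w < c)%E) ->
  measurable_fun setT (fun z : \bar R * T => at_etime X z.1 z.2).
Proof.
move=> X_right; apply: (measurability _ (ErealGenInftyO.measurableE R)) => //.
move=> /= _ [_ [c ->] <-]; rewrite preimage_itvNyo setTI.
rewrite [X in measurable X](_ : _ =
  [set z | z.1 \is a fin_num] `&` \bigcup_(q : rat)
  ([set y | y < (ratr q)%:E] `*`
    [set w | X (Num.max 0 (ratr q))%R w < c%:E])%E).
  apply: measurableI => //; apply: bigcupT_measurable_rat => q.
  apply: measurableX.
    by rewrite -set_itvNyo; exact: emeasurable_itv.
  rewrite -[X in measurable X]setTI; apply: emeasurable_fun_infty_o => //.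
  by apply: mX; rewrite le_max lexx.
apply/seteqP; split => -[[r| |] w] //=.
- move=> /X_right; rewrite le_max lexx => /(_ isT)[s].
  rewrite gt_max => /andP[s0 rs] Xc; split => //.
  have /rat_in_itvoo[q] := rs; rewrite in_itv/= => /andP[rq qs].
  exists q => //; split=> //=.
  rewrite (le_lt_trans _ Xc)//.
  by have := le_at w (ltW qs); rewrite (max_r (ltW s0)).
- move=> [_ [q _ [/= rq Xc]]]; rewrite (le_lt_trans _ Xc)// le_at//.
  by rewrite ltW// -lte_fin.
- by case.
- by case.
Qed.

End joint_measurability.

Section right_continuous_process.
Context d (T : measurableType d) (R : realType) (X : R -> T -> R).
Hypothesis mX : forall t, 0 <= t -> measurable_fun setT (X t).
Hypothesis X_incr : increasing_process X.
Hypothesis X_right : forall w t, 0 <= t -> X ^~ w @ t^'+ --> X t w.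

Lemma right_continuous_measurable_at_etime_EFin :
  measurable_fun setT
    (fun z : \bar R * T => at_etime (fun t w => (X t w)%:E) z.1 z.2).
Proof.
apply: right_continuous_measurable_at_etime => //.
- by move=> t t0; apply/measurable_EFinP; exact: mX.
- move=> w t [c| |]//= t0 Xc; last first.
    by exists (t + 1); rewrite ?ltrDl// ltry.
  move: Xc; rewrite lte_fin => Xc; have : \forall s \near t^'+, X s w < c.
    by apply: (cvgr_lt (X t w)) => //; exact: X_right.
  move=> H; have : \forall s \near t^'+, t < s /\ X s w < c.
    by near=> s; split; near: s => //; exact: nbhs_right_gt.
  by move=> /filter_ex[s [ts Xs]]; exists s => //; rewrite lte_fin.
Unshelve. all: by end_near. Qed.

Lemma right_continuous_measurable_process :
  measurable_fun setT (fun z : R * T => X (Num.max 0 z.1) z.2).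
Proof.
apply/measurable_EFinP.
have mz : measurable_fun setT ((fun z => (z.1%:E, z.2)) : R * T -> \bar R * T).
  by apply: measurable_fun_pair => //; apply/measurable_EFinP.
exact: (measurableT_comp right_continuous_measurable_at_etime_EFin mz).
Qed.

End right_continuous_process.

(** * Levy measures under subordination *)

Lemma eq_in_law_integral d1 d2 d' (T1 : measurableType d1)
    (T2 : measurableType d2) (V : measurableType d') (R : realType)
    (P1 : probability T1 R) (P2 : probability T2 R)
    (X : T1 -> V) (Y : T2 -> V) (f : V -> \bar R) :
  eq_in_law P1 P2 X Y -> measurable_fun setT f -> (forall x, 0 <= f x)%E ->
  (\int[P1]_w f (X w) = \int[P2]_w f (Y w))%E.
Proof.
move=> [mX mY XY] mf f0.
pose X' : {mfun T1 >-> V} := mfun_Sub (mem_set mX).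
pose Y' : {mfun T2 >-> V} := mfun_Sub (mem_set mY).
transitivity (\int[distribution P1 X']_x f x)%E.
  by rewrite ge0_integral_distribution.
rewrite (eq_measure_integral (distribution P2 Y')).
  by rewrite ge0_integral_distribution.
by move=> A mA _; exact: XY.
Qed.

Lemma expectationE d (T : measurableType d) (R : realType)
  (P : probability T R) (X : T -> R) : ('E_P[X] = \int[P]_w (X w)%:E)%E.
Proof. by rewrite unlock. Qed.

Section subordinator_facts.
Context d (T : measurableType d) (R : realType) (P : probability T R).
Variables (X : R -> T -> R) (psi : R -> R) (HX : subordinator P X psi).

Lemma subordinator_ge0 t w : 0 <= t -> 0 <= X t w.
Proof.
move=> t0; rewrite -(subordinator_start HX w).
exact: (subordinator_increasing HX).
Qed.

Lemma measurable_law_subordinator (B : set R) : measurable B ->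
  measurable_fun setT (fun y : R => P [set w | B (X (Num.max 0 y) w)]).
Proof.
move=> mB; have mX := right_continuous_measurable_process
  (subordinator_measurable HX) (subordinator_increasing HX)
  (subordinator_right_continuous HX).
pose A := [set z : R * T | B (X (Num.max 0 z.1) z.2)].
have mA : measurable A by rewrite -[X in measurable X]setTI; exact: mX.
rewrite (_ : (fun y : R => _) = P \o xsection A); last first.
  apply/funext => y /=; congr (P _); apply/seteqP.
  split => w /=; rewrite /xsection/=.
    by move=> ?; rewrite inE.
  by rewrite inE.
exact: measurable_fun_xsection.
Qed.

End subordinator_facts.

Section levy_measure_facts.
Context (R : realType) (nu : {measure set R -> \bar R}).
Hypothesis nuL : levy_measure nu.

(** Markov's inequality for the function [min 1 x]. *)
Lemma levy_measure_tail_lty (a : R) : 0 < a -> (nu `]a, +oo[%classic < +oo)%E.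
Proof.
move=> a0; have m0 : 0 < Num.min 1 a by rewrite lt_min ltr01.
suff : ((Num.min 1 a)%:E * nu `]a, +oo[%classic < +oo)%E.
  have := measure_ge0 nu `]a, +oo[%classic.
  case: (nu _) => [r _ _|_|//]; first by rewrite ltry.
  by rewrite gt0_muley ?lte_fin.
apply: le_lt_trans nuL.2; rewrite -integral_cst//.
have mmin : measurable_fun setT (fun x : R => (Num.min 1 x)%:E).
  by apply/measurable_EFinP; exact: measurable_minr.
apply: (@le_trans _ _ (\int[nu]_(x in `]a, +oo[) (Num.min 1 x)%:E)%E).
  apply: ge0_le_integral => //.
  - by move=> x _; rewrite lee_fin ltW.
  - exact: measurable_funTS mmin.
  - move=> x /=; rewrite in_itv/= andbT => ax; rewrite lee_fin.
    by rewrite le_min !ge_min lexx (ltW ax) orbT.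
apply: ge0_subset_integral => //.
- exact: measurable_funTS mmin.
- by move=> x /=; rewrite in_itv/= andbT => x0; rewrite lee_fin le_min ler01 ltW.
- by move=> x /=; rewrite !in_itv/= !andbT; exact: lt_trans.
Qed.

Lemma levy_measure_sigma_finite : sigma_finite setT nu.
Proof.
(* The half-line of nonpositive numbers is null. *)
exists (fun n => `]-oo, 0%R] `|` `]n.+1%:R^-1, +oo[)%classic.
  apply/esym; rewrite -subTset => x _.
  have [x0|x0] := leP x 0; first by exists 0%N => //; left; rewrite /= in_itv.
  exists (Num.truncn x^-1) => //; right; rewrite /= in_itv/= andbT.
  rewrite invf_plt ?posrE ?ltr0n//.
  exact: truncnS_gt.
move=> n; have mn : measurable (`]n.+1%:R^-1, +oo[%classic : set R) by [].
split; first exact: measurableU.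
apply: (le_lt_trans (measureU2 _ _ _)) => //.
suff : (nu [set` `]-oo, 0%R]] + nu `]n.+1%:R^-1%R, +oo[%classic < +oo)%E by [].
by rewrite nuL.1 add0e levy_measure_tail_lty// invr_gt0.
Qed.

End levy_measure_facts.

(** Bounds the Levy integrability function by the integrand of the Laplace
    exponent, through [x / (1 + x) <= 1 - exp (- x)]. *)
Lemma min1_le_expR (R : realType) (x : R) : 0 < x ->
  Num.min 1 x <= 2 * (1 - expR (- x)).
Proof.
move=> x0; have := expR_ge1Dx x; have := expR_gt0 x.
rewrite expRN; set e := expR x => e0 ex.
have x1 : 0 < 1 + x by rewrite addr_gt0.
have : e^-1 <= (1 + x)^-1 by rewrite lef_pV2.
move=> ele; apply: (@le_trans _ _ (2 * (1 - (1 + x)^-1))); last first.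
  by rewrite ler_pM2l// lerD2l lerN2.
have -> : 1 - (1 + x)^-1 = x / (1 + x).
  by field; rewrite gt_eqF.
rewrite mulrA ler_pdivlMr//.
have [x1'|x1'] := leP 1 x; rewrite ?mul1r ?mulrDr; nra.
Qed.

Section subordinated_levy_measure.
Context d (T : measurableType d) (R : realType) (P : probability T R).
Variables (X : R -> T -> R) (psiX : R -> R) (HX : subordinator P X psiX).
Hypothesis psiX_gt0 : forall omega, 0 < omega -> 0 < psiX omega.
Variables (nuY : {measure set R -> \bar R}) (psiY : R -> R).
Hypothesis nuYP : driftless_exponent nuY psiY.

Let phi (z : R * T) : R := X (Num.max 0 z.1) z.2.

Let mphi : measurable_fun setT phi.
Proof.
exact: right_continuous_measurable_process (subordinator_measurable HX)
  (subordinator_increasing HX) (subordinator_right_continuous HX).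
Qed.

Let phi_ge0 z : 0 <= phi z.
Proof. by apply: (subordinator_ge0 HX); rewrite le_max lexx. Qed.

Let mD : measurable (`]0%R, +oo[%classic : set R). Proof. by []. Qed.

Let nuY_sf : set R -> \bar R := nuY.
HB.instance Definition _ := Measure.on nuY_sf.
HB.instance Definition _ := @Measure_isSigmaFinite.Build _ _ _ nuY_sf
  (levy_measure_sigma_finite nuYP.1).

Let mu : {measure set R -> \bar R} :=
  measure_function_pushforward__canonical__measure_function_Measure
    ((nuY_sf \x P)%E : {measure set _ -> \bar R}) mphi.

(** The Levy measure of the time-changed process: the image under [X] of
    [nuY \x P], that is the mixture over jump sizes [s] of the time change of
    the laws of [X s]. Cutting at 0 discards the time jumps during which [X]
    does not move. *)
Definition subordinated_levy_measure : {measure set R -> \bar R} :=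
  mrestr mu mD.

(** The condition at 0 makes the cut at 0 invisible, so that the integral is
    the iterated one. *)
Let integral_nu (g : R -> \bar R) : measurable_fun setT g ->
  (forall x, 0 <= g x)%E -> g 0 = 0%E ->
  (\int[subordinated_levy_measure]_(x in `]0%R, +oo[) g x =
   \int[nuY]_(s in `]0%R, +oo[) \int[P]_w g (X s w))%E.
Proof.
move=> mg g0 g00.
rewrite (eq_measure_integral mu); last first.
  by move=> A mA AD; rewrite /= /mrestr setIidl.
rewrite ge0_integral_pushforward//; last exact: measurable_funTS.
rewrite integral_mkcond/=.
transitivity (\int[nuY_sf \x P]_z g (phi z))%E.
  apply: eq_integral => z _; rewrite patchE; case: ifPn => // /negP zD.
  have [zle|zgt] := leP (phi z) 0.
    by rewrite (_ : phi z = 0) ?g00//; apply/eqP; rewrite eq_le zle phi_ge0.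
  by exfalso; apply: zD; rewrite inE /= in_itv/= zgt.
rewrite fubini_tonelli1//=; last exact: measurableT_comp.
rewrite [RHS]integral_mkcond; apply: eq_integral => s _.
rewrite patchE /fubini_F /phi/=; case: ifPn.
  by rewrite inE/= in_itv/= andbT => s0; rewrite max_r ?(ltW s0).
move=> /negP sD; have s0 : s <= 0.
  by rewrite leNgt; apply/negP => s0; apply: sD; rewrite inE /= in_itv/= s0.
rewrite integral0_eq// => w _; rewrite max_l//.
by rewrite (subordinator_start HX).
Qed.

Let m1expR omega : measurable_fun setT
  (fun x : R => (1 - expR (- (omega * Num.max 0 x)))%:E).
Proof.
apply/measurable_EFinP; apply: measurable_funB => //.
apply: measurableT_comp => //; apply: measurableT_comp => //.
by apply: measurable_funM => //; exact: measurable_maxr.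
Qed.

(** For a fixed jump size [s] of the time change, the mean of
    [1 - exp (- (omega * X s))] is [1 - exp (- (s * psiX omega))], which is the
    integrand of [psiY] at the frequency [psiX omega]. *)
Let formula omega : 0 < omega ->
  (psiY (psiX omega))%:E =
  (\int[subordinated_levy_measure]_(x in `]0%R, +oo[)
    (1 - expR (- (omega * x)))%:E)%E.
Proof.
move=> o0; rewrite (nuYP.2 _ (psiX_gt0 o0)).
transitivity (\int[subordinated_levy_measure]_(x in `]0%R, +oo[)
    (1 - expR (- (omega * Num.max 0%R x)))%:E)%E; last first.
  apply: eq_integral => x; rewrite inE/= in_itv/= andbT => x0.
  by rewrite max_r ?ltW.
rewrite integral_nu//; last 2 first.
- move=> x; rewrite lee_fin subr_ge0 -[leRHS]expR0 ler_expR oppr_le0.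
  by rewrite mulr_ge0//; [exact: ltW|rewrite le_max lexx].
- by rewrite maxxx mulr0 oppr0 expR0 subrr.
apply: eq_integral => s; rewrite inE/= in_itv/= andbT => /ltW s0.
have Xs0 w : 0 <= X s w by exact: (subordinator_ge0 HX).
under eq_integral do rewrite max_r//.
have mE : measurable_fun setT (fun w => expR (- (omega * X s w))).
  apply: measurableT_comp => //; apply: measurableT_comp => //.
  by apply: measurable_funM => //; exact: (subordinator_measurable HX).
have L := subordinator_laplace HX s0 o0; rewrite expectationE in L.
under eq_integral do rewrite EFinB.
rewrite integralB_EFin//=; last 2 first.
- exact: finite_measure_integrable_cst.
- apply/integrableP; split; first exact/measurable_EFinP.
  under eq_integral => w _.
    rewrite gee0_abs; last by rewrite lee_fin expR_ge0.
    over.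
  by rewrite L ltry.
rewrite L integral_cst// mul1e EFinB mulrC; congr (_ - _)%E.
by symmetry; exact: probability_setT.
Qed.

(** Integrability of [min 1 x] comes from the finiteness of the exponent at
    frequency 1. *)
Lemma driftless_exponent_comp :
  exists nu, driftless_exponent nu (psiY \o psiX).
Proof.
exists subordinated_levy_measure; split; last exact: formula.
split.
  rewrite /= /mrestr (_ : _ `&` _ = set0) ?measure0//.
  apply/seteqP; split => x //=; rewrite !in_itv/= andbT => -[x0 /lt_le_trans].
  by move=> /(_ _ x0); rewrite ltxx.
have m1 : measurable_fun setT (fun x : R => (1 - expR (- (1 * x)))%:E).
  under eq_fun do rewrite mul1r.
  apply/measurable_EFinP; apply: measurable_funB => //.
  by apply: measurableT_comp => //; exact: measurable_funN.
apply: (@le_lt_trans _ _ (\int[subordinated_levy_measure]_(x in `]0%R, +oo[)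
   (2%:E * (1 - expR (- (1 * x)))%:E))%E).
  apply: ge0_le_integral => //.
  - move=> x /=; rewrite in_itv/= andbT => x0.
    by rewrite lee_fin le_min ler01 ltW.
  - by apply: measurable_funTS; apply/measurable_EFinP; exact: measurable_minr.
  - by apply: measurable_funeM; exact: measurable_funTS.
  - move=> x /=; rewrite in_itv/= andbT => x0.
    by rewrite -EFinM lee_fin mul1r min1_le_expR.
rewrite ge0_integralZl//.
- by rewrite -formula// -EFinM ltry.
- exact: measurable_funTS.
- move=> x /=; rewrite in_itv/= andbT => x0.
  by rewrite lee_fin subr_ge0 -[leRHS]expR0 ler_expR oppr_le0 mul1r ltW.
Qed.

End subordinated_levy_measure.

(** * Subordination of independent subordinators *)

Section subordination.
Context d (T : measurableType d) (R : realType) (P : probability T R).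
Variables (C1 C2 : set (set T)) (CC : independent_pi_systems P C1 C2).
Variables (X Y : R -> T -> R) (psiX psiY : R -> R).
Hypotheses (HX : subordinator P X psiX) (HY : subordinator P Y psiY).
Hypothesis mX : forall t, 0 <= t ->
  measurable_fun [set: g_sigma_algebraType C2] (X t).
Hypothesis mY : forall t, 0 <= t ->
  measurable_fun [set: g_sigma_algebraType C1] (Y t).
Local Notation T1 := (g_sigma_algebraType C1).
Local Notation T2 := (g_sigma_algebraType C2).
Local Notation XY := (comp_process X Y).

Let h (B : set R) (y : R) := P [set w | B (X (Num.max 0 y) w)].

Let mXX : measurable_fun [set: R * T2] (fun z => X (Num.max 0 z.1) z.2).
Proof.
exact: right_continuous_measurable_process mX (subordinator_increasing HX)
  (subordinator_right_continuous HX).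
Qed.

Let XYE t w : 0 <= t -> XY t w = X (Num.max 0 (Y t w)) w.
Proof. by move=> t0; rewrite max_r// (subordinator_ge0 HY). Qed.

Let mXY12 t : 0 <= t ->
  measurable_fun [set: T1 * T2] (fun z => X (Num.max 0 (Y t z.1)) z.2).
Proof.
move=> t0; have mp : measurable_fun [set: T1 * T2]
    (fun z : T1 * T2 => (Y t z.1, z.2) : R * T2).
  apply: measurable_fun_pair => //.
  exact: measurableT_comp (mY t0) measurable_fst.
exact: measurableT_comp mXX mp.
Qed.

Let mdiag : measurable_fun [set: T] ((fun w => (w, w)) : T -> T1 * T2).
Proof.
have mid1 := measurable_idfun_g_sigma (pi_system1_measurable CC).
have mid2 := measurable_idfun_g_sigma (pi_system2_measurable CC).
exact: (measurable_fun_pair mid1 mid2).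
Qed.

Let mXY t : 0 <= t -> measurable_fun setT (XY t).
Proof.
move=> t0; rewrite (_ : XY t = (fun z => X (Num.max 0 (Y t z.1)) z.2) \o
  ((fun w => (w, w)) : T -> T1 * T2)).
  exact: measurableT_comp (mXY12 t0) mdiag.
by apply/funext => w; exact: XYE.
Qed.

(** Freeze [Y]. At the frozen times [Y (t i) w] the increments of [X] are
    independent, and by stationarity the law of each depends on the increment of
    [Y] only; the product of functions of the increments of [Y] that results
    factorizes because these are independent too. *)
Let joint_increments n (t : nat -> R) (B : 'I_n -> set R) :
  0 <= t 0%N -> {homo t : i j / (i <= j)%N >-> i <= j} ->
  (forall i, measurable (B i)) ->
  P (\bigcap_(i in [set: 'I_n])
      (fun w => XY (t i.+1) w - XY (t i) w) @^-1` B i) =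
  (\prod_(i < n) \int[P]_w h (B i) (Y (t i.+1 - t i) w))%E.
Proof.
move=> t0 ti mB.
have tge0 i : 0 <= t i by rewrite (le_trans t0)// ti.
have tle (i : nat) : t i <= t i.+1 by exact: ti.
pose E := [set z : T1 * T2 | forall i : 'I_n,
  B i (X (Num.max 0 (Y (t i.+1) z.1)) z.2 - X (Num.max 0 (Y (t i) z.1)) z.2)].
have mE : measurable E.
  rewrite (_ : E = \bigcap_(i in [set: 'I_n])
     (fun z : T1 * T2 => X (Num.max 0 (Y (t i.+1) z.1)) z.2 -
       X (Num.max 0 (Y (t i) z.1)) z.2) @^-1` B i).
    apply: fin_bigcap_measurable; first exact: finite_finset.
    move=> i _; rewrite -[X in measurable X]setTI.
    by apply: measurable_funB => //; exact: mXY12.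
  by apply/seteqP; split => z /= zE i => [_|]; exact: zE.
transitivity (P [set w | E (w, w)]).
  congr (P _); apply/seteqP; split => w /= wB i => [|_].
    by have := wB i Logic.I; rewrite /= !XYE.
  by have := wB i; rewrite /= !XYE.
rewrite (probability_diagonal CC mE).
transitivity (\int[P]_w \prod_(i < n) h (B i) (Y (t i.+1) w - Y (t i) w))%E.
  apply: eq_integral => w _.
  have Yge0 i : 0 <= Y (t i) w by exact: (subordinator_ge0 HY).
  have Yle : {homo (fun i => Y (t i) w) : i j / (i <= j)%N >-> i <= j}.
    by move=> i j ij; apply: (subordinator_increasing HY) => //; exact: ti.
  transitivity (P (\bigcap_(i in [set: 'I_n])
      (fun w' => X (Y (t i.+1) w) w' - X (Y (t i) w) w') @^-1` B i)).
    congr (P _); apply/seteqP; split => w' /= wB i => [_|].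
      by have := wB i; rewrite /= !max_r.
    by have := wB i Logic.I; rewrite /= !max_r.
  rewrite (subordinator_indep_increments HX (Yge0 0%N) Yle)//.
  apply: eq_bigr => i _; rewrite /h max_r ?subr_ge0 ?Yle//.
  have Yi := Yle i i.+1 (leqnSn _).
  by have [_ _ ->] := subordinator_stationary HX (Yge0 i) Yi.
rewrite (@expectation_prod_indep _ _ _ _ n
  (fun i w => Y (t i.+1) w - Y (t i) w) (fun i => h (B i)))//.
- apply: eq_bigr => i _; apply: eq_in_law_integral => //.
    exact: (subordinator_stationary HY).
  exact: (measurable_law_subordinator HX).
- by move=> i; apply: measurable_funB; exact: (subordinator_measurable HY).
- by move=> i; exact: (measurable_law_subordinator HX).
- exact: (subordinator_indep_increments HY).
Qed.

Let one_increment s t (B : set R) : 0 <= s -> s <= t -> measurable B ->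
  P ((fun w => XY t w - XY s w) @^-1` B) = (\int[P]_w h B (Y (t - s)%R w))%E.
Proof.
move=> s0 st mB; pose u i := if i is 0%N then s else t.
have := @joint_increments 1 u (fun=> B) s0 _ (fun=> mB).
rewrite big_ord1/= => <-.
  congr (P _); apply/seteqP; split => w /= wB => [i _|].
    by rewrite /= (ord1 i).
  exact: (wB ord0 Logic.I).
(* [u] is monotone: its only values are s, then t forever. *)
by move=> [|i] [|j].
Qed.

Let XY0 w : XY 0 w = 0.
Proof. by rewrite /XY (subordinator_start HY) (subordinator_start HX). Qed.

Let XY_stationary s t : 0 <= s -> s <= t ->
  eq_in_law P P (fun w => XY t w - XY s w) (XY (t - s)).
Proof.
move=> s0 st; split.
- by apply: measurable_funB; apply: mXY => //; exact: le_trans st.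
- by apply: mXY; rewrite subr_ge0.
- move=> B mB; rewrite one_increment//.
  rewrite (_ : XY (t - s) = (fun w => XY (t - s) w - XY 0 w)); last first.
    by apply/funext => w; rewrite XY0 subr0.
  by rewrite one_increment// ?subr_ge0// subr0.
Qed.

Let XY_indep_increments (n : nat) (t : nat -> R) :
  0 <= t 0%N -> {homo t : i j / (i <= j)%N >-> i <= j} ->
  indep_rvs P (fun (i : 'I_n) w => XY (t i.+1) w - XY (t i) w).
Proof.
move=> t0 ti B mB; rewrite joint_increments//; apply: eq_bigr => i _.
by rewrite one_increment ?ti// (le_trans t0)// ti.
Qed.

Let XY_increasing : increasing_process XY.
Proof.
move=> w s t s0 st; apply: (subordinator_increasing HX).
  exact: (subordinator_ge0 HY).
exact: (subordinator_increasing HY).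
Qed.

(** [Y] approaches [Y t] from above, where [X] is right-continuous. *)
Let XY_right_continuous w t : 0 <= t -> XY ^~ w @ t^'+ --> XY t w.
Proof.
move=> t0; apply/cvgrPdist_lt => e e0.
have Yt0 := subordinator_ge0 HY w t0.
have /cvgrPdist_lt/(_ e e0) :=
  @subordinator_right_continuous _ _ _ _ _ _ HX w _ Yt0.
rewrite near_withinE /= => -[del/= del0 Hdel].
have /cvgrPdist_lt/(_ del del0) Ynear :=
  @subordinator_right_continuous _ _ _ _ _ _ HY w _ t0.
near=> s.
have ts : t < s by near: s; exact: nbhs_right_gt.
have Yts : Y t w <= Y s w by exact/(subordinator_increasing HY)/ltW.
move: Yts; rewrite le_eqVlt => /predU1P[Yts|Yts].
  by rewrite /XY -Yts subrr normr0.
by apply: Hdel => //; rewrite /ball/=; near: s; exact: Ynear.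
Unshelve. all: by end_near. Qed.

Hypothesis psiX_gt0 : forall omega, 0 < omega -> 0 < psiX omega.

(** Averaging over [X] first, at the frozen time [Y t w], leaves the Laplace
    transform of [Y t] at [psiX omega]; this frequency is positive by the
    hypothesis on [psiX]. *)
Let XY_laplace t omega : 0 <= t -> 0 < omega ->
  ('E_P[fun w => expR (- (omega * XY t w))] =
   (expR (- (t * psiY (psiX omega))))%:E)%E.
Proof.
move=> t0 omega0.
rewrite -(subordinator_laplace HY t0 (psiX_gt0 omega0)) !expectationE.
pose f (z : T1 * T2) := (expR (- (omega * X (Num.max 0 (Y t z.1)) z.2)))%:E.
have mf : measurable_fun setT f.
  apply/measurable_EFinP; apply: measurableT_comp => //.
  apply: measurableT_comp => //; apply: measurable_funM => //.
  exact: mXY12.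
transitivity (\int[P]_w f (w, w))%E.
  by apply: eq_integral => w _; rewrite /f -XYE.
rewrite (integral_diagonal CC mf); last by move=> z; rewrite lee_fin expR_ge0.
apply: eq_integral => w _.
have Yt0 := subordinator_ge0 HY w t0.
have := subordinator_laplace HX Yt0 omega0; rewrite expectationE mulrC => <-.
by rewrite /f/= max_r.
Qed.

Lemma subordinator_comp : subordinator P XY (psiY \o psiX).
Proof.
split => //; have [nu nuY] := subordinator_zero_drift HY.
exact: (driftless_exponent_comp HX psiX_gt0 nuY).
Qed.

End subordination.

(** * Quantiles and paths of quantile clocks *)

Section quantile_facts.
Context d (T : measurableType d) (R : realType) (P : probability T R).
Variable X : {RV P >-> R}.
Local Notation Q := (quantile X).

Lemma quantile_ge0 u : (0 <= Q u)%E.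
Proof. by apply: le_ereal_inf_tmp => _ [t [t0 _] <-]; rewrite lee_fin. Qed.

Lemma quantile0 : Q 0 = 0%E.
Proof.
apply/eqP; rewrite eq_le quantile_ge0 andbT; apply: ereal_inf_lbound.
by exists 0 => //; split => //; exact: cdf_ge0.
Qed.

Lemma le_quantile u v : u <= v -> (Q u <= Q v)%E.
Proof.
move=> uv; apply: ereal_inf_le_tmp => _ [t [t0 vt] <-]; exists t => //.
by split => //; apply: le_trans vt; rewrite lee_fin.
Qed.

(** If the quantiles at all levels below [u] are at most [c], then the cdf just
    above [c] is at least every level below [u], hence at least [u]. *)
Lemma quantile_left_continuous u c :
  (c < Q u)%E -> exists2 v, v < u & (c < Q v)%E.
Proof.
move=> cQ; apply: contrapT => H.
have Qc v : v < u -> (Q v <= c)%E.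
  by move=> vu; rewrite leNgt; apply/negP => cv; apply: H; exists v.
have c0 : (0 <= c)%E.
  by apply: le_trans (quantile_ge0 (u - 1)) (Qc _ _); rewrite ltrBlDr ltrDl.
case: c => [c| |] in cQ H Qc c0 *; last 2 first.
- by move: cQ; rewrite ltNge leey.
- by move: c0; rewrite leNgt ltNyr.
move: cQ; rewrite ltNge => /negP; apply; apply/lee_addgt0Pr => e e0.
rewrite -EFinD; apply: ereal_inf_lbound; exists (c + e) => //.
split; first by rewrite addr_ge0// ltW.
have Fc v : v < u -> (v%:E <= cdf X (c + e))%E.
  move=> vu; have : (Q v < (c + e)%:E)%E.
    by apply: le_lt_trans (Qc _ vu) _; rewrite lte_fin ltrDl.
  move=> /ereal_inf_lt[_ [t [t0 vt] <-]]; rewrite lte_fin => tc.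
  by apply: (le_trans vt); apply: cdf_nondecreasing; exact: ltW.
apply/lee_subgt0Pr => r r0; rewrite -EFinB; apply: Fc.
by rewrite ltrBlDr ltrDl.
Qed.

(** A zero quantile would make the cdf at least [u] at every positive time,
    hence at 0 by right continuity, whereas a positive variable has no mass
    there. *)
Lemma quantile_gt0 u : clock_variable X -> 0 < u -> (0 < Q u)%E.
Proof.
move=> hX u0.
have F0 : cdf X 0 = 0%E.
  have mpos : measurable [set w | 0 < X w].
    rewrite -[X in measurable X]setTI -[[set w | _]]/(X @^-1` [set x | 0 < x]).
    by apply: measurable_funP => //; rewrite -set_itvoy; exact: measurable_itv.
  have -> : cdf X 0 = P (~` [set w | 0 < X w]).
    congr (P _); apply/seteqP; split => w /=; rewrite in_itv/= leNgt.
      by move/negP.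
    by move/negP.
  by rewrite probability_setC// (clock_variable_pos hX) subee.
rewrite lt_neqAle quantile_ge0 andbT; apply/negP => /eqP Q0.
have Fe e : 0 < e -> (u%:E <= cdf X e)%E.
  move=> e0; have : (Q u < e%:E)%E by rewrite -Q0 lte_fin.
  move=> /ereal_inf_lt[_ [t [t0 ut] <-]]; rewrite lte_fin => te.
  by apply: (le_trans ut); apply: cdf_nondecreasing; exact: ltW.
have : (u%:E <= cdf X 0)%E.
  apply: (cvge_to_ge (@cdf_right_continuous _ _ _ _ X 0)).
  by near=> e; apply: Fe; near: e; exact: nbhs_right_gt.
by rewrite F0 lee_fin leNgt u0.
Unshelve. all: by end_near. Qed.

End quantile_facts.

Lemma lebesgue_stieltjes_measure_itvoc (R : realType) (f : cumulative R R)
    (a b : R) : a <= b ->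
  lebesgue_stieltjes_measure f `]a, b]%classic = (f b - f a)%:E.
Proof.
move=> ab.
rewrite /lebesgue_stieltjes_measure /measure_extension measurable_mu_extE/=.
  by rewrite wlength_itv_bnd.
by exists (a, b).
Qed.

(** The integrand [q t s] grows with [t], and it vanishes for [s >= t] since
    the quantile at level 0 is 0. So the integration domain can be enlarged
    freely, and the monotonicity and left continuity of the quantile pass to the
    clock. *)
Section clock_paths.
Context d (T : measurableType d) (R : realType) (P : probability T R).
Variables (X : {RV P >-> R}) (L : T -> cumulative R R).
Local Notation Q := (quantile X).
Local Notation C := (quantile_clock X L).
Local Notation RL := (measurableTypeR R).

Let q (t : R) (s : RL) : \bar R := Q (Num.max 0 (1 - (s : R) / t)).

Let q_ge0 t s : (0 <= q t s)%E. Proof. exact: quantile_ge0. Qed.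

Lemma measurable_quantile_clock_integrand t :
  0 < t -> measurable_fun [set: RL] (q t).
Proof.
move=> t0; apply: (measurability _ (ErealGenOInfty.measurableE R)) => //.
move=> /= _ [_ [c ->] <-]; rewrite preimage_itvoy setTI.
apply: (@is_interval_measurable R) => x y /= cx cy z /andP[xz zy].
apply: (lt_le_trans cy); apply: le_quantile.
rewrite ge_max !le_max lexx/= lerD2l lerN2.
by rewrite ler_pM2r ?invr_gt0// zy orbT.
Qed.

Let le_q s t x : 0 < s -> s <= t -> 0 <= x -> (q s x <= q t x)%E.
Proof.
move=> s0 st x0; apply: le_quantile; rewrite ge_max !le_max lexx/= lerD2l lerN2.
by rewrite ler_wpM2l ?orbT// lef_pV2// posrE// (lt_le_trans s0).
Qed.

Let q_eq0 t x : 0 < t -> t <= x -> q t x = 0%E.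
Proof.
move=> t0 tx; rewrite /q max_l ?quantile0//.
by rewrite subr_le0 ler_pdivlMr// mul1r.
Qed.

Lemma quantile_clock0 w : C 0 w = 0%E.
Proof. by rewrite /quantile_clock set_itvoc0 integral_set0. Qed.

Lemma quantile_clock_ge0 t w : (0 <= C t w)%E.
Proof. by apply: integral_ge0 => s _; exact: quantile_ge0. Qed.

Lemma quantile_clock_increasing : increasing_process C.
Proof.
move=> w s t s_ge0 st; have [s0|s0] := ltP 0 s; last first.
  rewrite (_ : s = 0); last by apply/eqP; rewrite eq_le s0 s_ge0.
  by rewrite quantile_clock0 quantile_clock_ge0.
have t0 : 0 < t by exact: lt_le_trans st.
apply: (@le_trans _ _
  (\int[lebesgue_stieltjes_measure (L w)]_(x in `]0%R, s]) q t x)%E).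
  apply: ge0_le_integral => //.
  - by move=> x _; exact: quantile_ge0.
  - exact: measurable_funTS (measurable_quantile_clock_integrand s0).
  - exact: measurable_funTS (measurable_quantile_clock_integrand t0).
  - by move=> x /=; rewrite in_itv/= => /andP[/ltW x0 _]; exact: le_q.
apply: ge0_subset_integral => //.
- exact: measurable_funTS (measurable_quantile_clock_integrand t0).
- by move=> x /=; rewrite !in_itv/= => /andP[-> /le_trans]; exact.
Qed.

(** Monotone convergence along times [t_ n] increasing to [t]: by left
    continuity of the quantile the integrands increase to [q t], even at the end
    point [s = t]. No right continuity is to be expected, since a jump of [L] at
    time [t] enters the clock just after [t] with weight the lower end of the
    support of [X], which may be positive. *)
Lemma quantile_clock_left_continuous w t c : 0 < t -> (c < C t w)%E ->
  exists2 s, 0 <= s < t & (c < C s w)%E.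
Proof.
move=> t0 cC.
(* Chosen so that x / t_ n exceeds x / t by x / t / n.+1 exactly. *)
pose t_ n := t * (n.+1%:R / n.+2%:R).
have t_gt0 n : 0 < t_ n by rewrite mulr_gt0// divr_gt0.
have t_lt n : t_ n < t.
  by rewrite gtr_pMr// ltr_pdivrMr// mul1r ltr_nat.
have t_homo : {homo t_ : m n / (m <= n)%N >-> m <= n}.
  move=> m n mn; rewrite ler_pM2l// ler_pdivrMr// mulrAC ler_pdivlMr//.
  rewrite -!natrM ler_nat mulnS [leqRHS]mulnS [X in (_ + X <= _)%N]mulnC.
  by rewrite leq_add2r ltnS.
have q_lim x : 0 < x -> x <= t -> limn (fun n => q (t_ n) x) = q t x.
  move=> x0 xt; apply/cvg_lim => //.
  have -> : q t x = ereal_sup (range (fun n => q (t_ n) x)).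
    apply/eqP; rewrite eq_le; apply/andP; split; last first.
      apply: ge_ereal_sup => _ [n _ <-]; apply: le_q => //; exact: ltW.
    rewrite leNgt; apply/negP => /quantile_left_continuous[v vu].
    apply/negP; rewrite -leNgt.
    have u0 : 0 <= 1 - x / t by rewrite subr_ge0 ler_pdivrMr// mul1r.
    move: vu; rewrite max_r// => vu.
    (* From this rank on, the level 1 - x / t_ n is above v. *)
    pose n := Num.truncn (x / t / (1 - x / t - v)).
    apply: (@le_trans _ _ (q (t_ n) x)); last first.
      by apply: ereal_sup_ubound; exists n.
    apply: le_quantile; rewrite le_max; apply/orP; right.
    have n_gt : x / t / (1 - x / t - v) < n.+1%:R by exact: truncnS_gt.
    have uv0 : 0 < 1 - x / t - v by rewrite subr_gt0.
    move: n_gt; rewrite ltr_pdivrMr// => n_gt.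
    have -> : x / t_ n = x / t + x / t / n.+1%:R.
      rewrite /t_ -[n.+2%:R]natr1; field.
      by rewrite gt_eqF//= ?gt_eqF// -?[1 + _]natr1 ?pnatr_eq0//.
    rewrite opprD addrA lerBrDl -lerBrDr.
    by rewrite ler_pdivrMr// [leRHS]mulrC ltW.
  apply: ereal_nondecreasing_cvgn => m n mn; apply: le_q => //.
    exact: t_homo.
  exact: ltW.
pose mu := lebesgue_stieltjes_measure (L w).
have CE n : C (t_ n) w = (\int[mu]_(x in `]0%R, t]) q (t_ n) x)%E.
  rewrite /quantile_clock [LHS]integral_mkcond [RHS]integral_mkcond.
  apply: eq_integral => x _; rewrite !patchE -/(q (t_ n) x).
  case: ifPn => [xs|xs]; case: ifPn => [xt|xt] //.
  - move: xs; rewrite inE/= in_itv/= => /andP[x0 xtn]; move/negP: xt; case.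
    by rewrite inE/= in_itv/= x0 (le_trans xtn)// ltW.
  - move: xt; rewrite inE/= in_itv/= => /andP[x0 _]; rewrite q_eq0//.
    rewrite leNgt; apply/negP => xtn; move/negP : xs; apply.
    by rewrite inE/= in_itv/= x0 ltW.
have : C t w = limn (fun n => C (t_ n) w).
  under eq_fun do rewrite CE; rewrite -monotone_convergence//.
  - rewrite /quantile_clock; apply: eq_integral => x.
    by rewrite inE/= in_itv/= => /andP[x0 xt]; rewrite q_lim.
  - move=> n.
    exact: measurable_funTS (measurable_quantile_clock_integrand (t_gt0 n)).
  - move=> x /=; rewrite in_itv/= => /andP[/ltW x0 _] m n mn.
    by apply: le_q => //; exact: t_homo.
have /ereal_nondecreasing_cvgn/cvg_lim -> // :
    nondecreasing_seq (fun n => C (t_ n) w).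
  by move=> m n mn; apply: quantile_clock_increasing; [exact: ltW|exact: t_homo].
move=> E; move: cC; rewrite E => /ereal_sup_gt[_ [n _ <-] cn].
by exists (t_ n) => //; rewrite (ltW (t_gt0 n)) t_lt.
Qed.

(** On the first part of the domain the integrand is at least its value at
    [s]. *)
Lemma quantile_clock_lower_bound w s t : 0 < s -> s <= t ->
  (Q (1 - s / t)%R * (L w s - L w 0)%:E <= C t w)%E.
Proof.
move=> s0 st; have t0 : 0 < t by exact: lt_le_trans st.
rewrite -lebesgue_stieltjes_measure_itvoc; last exact: ltW.
rewrite -integral_cst//.
apply: (@le_trans _ _ (\int[lebesgue_stieltjes_measure (L w)]_(x in `]0%R, s])
    q t x)%E).
  apply: ge0_le_integral => //.
  - by move=> x _; exact: quantile_ge0.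
  - exact: measurable_funTS (measurable_quantile_clock_integrand t0).
  - move=> x /=; rewrite in_itv/= => /andP[_ xs]; apply: le_quantile.
    by rewrite le_max lerD2l lerN2 ler_pM2r ?invr_gt0// xs orbT.
apply: ge0_subset_integral => //.
- exact: measurable_funTS (measurable_quantile_clock_integrand t0).
- by move=> x /=; rewrite !in_itv/= => /andP[-> /le_trans]; exact.
Qed.

End clock_paths.

(** * Measurability and positivity of quantile clocks *)

Section stieltjes_integral_measurable.
Context d (T : measurableType d) (R : realType) (L : T -> cumulative R R).
Hypothesis mL : forall t, 0 <= t -> measurable_fun setT (fun w => L w t).
Local Notation RL := (measurableTypeR R).
Local Notation mu w := (lebesgue_stieltjes_measure (L w)).

(** On half-open intervals the measure is an increment of [L]; Dynkin's
    theorem applies because the restriction to a bounded interval is finite. *)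
Let measurable_stieltjes_setI t (U : set RL) : 0 <= t -> measurable U ->
  measurable_fun setT (fun w => mu w (U `&` `]0%R, t]%classic)).
Proof.
move=> t0; have mD : @measurable _ RL `]0%R, t]%classic by exact: measurable_itv.
have moc (a b : R) : 0 <= a -> 0 <= b ->
    measurable_fun setT (fun w => mu w `]a, b]%classic).
  move=> a0 b0; have [ab|ba] := leP a b.
    under eq_fun do rewrite lebesgue_stieltjes_measure_itvoc//.
    by apply/measurable_EFinP; apply: measurable_funB; exact: mL.
  under eq_fun do rewrite set_itv_ge ?bnd_simp -?leNgt ?(ltW ba)// measure0.
  exact: measurable_cst.
apply: (@dynkin_induction _ RL (@ocitv R)
  (fun U => measurable_fun setT
    (fun w => mu w (U `&` `]0%R, t]%classic)))) => //.
- exact: ocitvI.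
- under eq_fun do rewrite setTI; exact: moc.
- move=> _ [[a b] _ <-] /=.
  have E : `]a, b]%classic `&` `]0%R, t]%classic =
      `](Num.max a 0), (Num.min b t)]%classic :> set R.
    apply/seteqP; split => x /=; rewrite !in_itv/= gt_max le_min.
      by move=> [/andP[-> ->] /andP[-> ->]].
    by move=> /andP[/andP[-> ->] /andP[-> ->]].
  under eq_fun do rewrite E.
  have [b0|b0] := leP 0 b.
    by apply: moc; rewrite ?le_max ?lexx ?orbT// le_min b0.
  under eq_fun do rewrite set_itv_ge ?bnd_simp -?leNgt ?measure0 ?ge_min ?le_max
    ?(ltW b0) ?orbT//.
  exact: measurable_cst.
- move=> V mV IH.
  have muD w : mu w (V `&` `]0%R, t]%classic) \is a fin_num.
    rewrite ge0_fin_numE ?measure_ge0//.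
    apply: (@le_lt_trans _ _ (mu w `]0%R, t]%classic)).
      by apply: le_measure; rewrite ?inE//; exact: measurableI.
    by rewrite lebesgue_stieltjes_measure_itvoc// ltry.
  rewrite (_ : (fun w => _) =
     (fun w => mu w `]0%R, t]%classic - mu w (V `&` `]0%R, t]%classic)))%E.
    by apply: emeasurable_funB => //; exact: moc.
  apply/funext => w; rewrite setIC -setDE measureD//=.
    by rewrite setIC.
  by rewrite lebesgue_stieltjes_measure_itvoc// ltry.
- move=> F mF tF IH.
  rewrite (_ : (fun w => _) =
     (fun w => \sum_(n <oo) mu w (F n `&` `]0%R, t]%classic)))%E.
    by apply: ge0_emeasurable_sum => // n w _ _; exact: measure_ge0.
  apply/funext => w; rewrite setI_bigcupl measure_semi_bigcup//.
  + by move=> n; exact: measurableI.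
  + exact: trivIset_setIr.
  + by apply: bigcupT_measurable => n; exact: measurableI.
Qed.

Lemma measurable_stieltjes_integral t (k : RL -> \bar R) : 0 <= t ->
  measurable_fun setT k -> (forall s, 0 <= k s)%E ->
  measurable_fun setT (fun w => \int[mu w]_(s in `]0%R, t]) k s)%E.
Proof.
move=> t0 mk k0.
have mD : @measurable _ RL `]0%R, t]%classic by exact: measurable_itv.
pose l w : {measure set RL -> \bar R} := mrestr (mu w) mD.
rewrite (_ : (fun w => _) = (fun w => \int[l w]_s (k \_ `]0%R, t]%classic) s)%E).
  apply: measurable_fun_integral_kernel.
  - by move=> U mU; exact: measurable_stieltjes_setI.
  - by move=> s; rewrite patchE; case: ifP.
  - by apply/(measurable_restrictT k mD); exact: measurable_funTS mk.
apply/funext => w; rewrite -integral_mkcond; apply: eq_measure_integral.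
by move=> A mA AD; rewrite /l/= /mrestr setIidl.
Qed.

End stieltjes_integral_measurable.

Section positivity.
Context d (T : measurableType d) (R : realType) (P : probability T R).

(** The nonnegative function [1 - exp (- (omega * Z))] has zero mean exactly
    when it vanishes almost surely. *)
Lemma expectation_expR_eq1 (Z : T -> R) omega : 0 < omega ->
  measurable_fun setT Z -> (forall w, 0 <= Z w) ->
  'E_P[fun w => expR (- (omega * Z w))]%E = 1%E <-> P [set w | Z w = 0] = 1%E.
Proof.
move=> o0 mZ Z0.
have mZ0 : measurable [set w | Z w = 0].
  rewrite -[X in measurable X]setTI -[[set w | _]]/(Z @^-1` [set 0]).
  by apply: mZ => //; exact: measurable_set1.
have me : measurable_fun setT (fun w => expR (- (omega * Z w))).
  apply: measurableT_comp => //; apply: measurable_funN.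
  by apply: measurable_funM.
have PC : P [set w | Z w = 0] = 1%E <-> P (~` [set w | Z w = 0]) = 0%E.
  rewrite probability_setC//; split=> [->|]; first by rewrite subee.
  have := probability_le1 P mZ0; have := measure_ge0 P [set w | Z w = 0].
  case: (P _) => // r; rewrite !lee_fin => _ _.
  by rewrite -EFinB => -[/subr0_eq <-].
rewrite expectationE PC; split=> [E|PZ].
  apply/negligibleP; first exact: measurableC.
  pose g w := (1 - expR (- (omega * Z w)))%:E : \bar R.
  have g0 w : (0 <= g w)%E.
    by rewrite lee_fin subr_ge0 -[leRHS]expR0 ler_expR oppr_le0 mulr_ge0// ltW.
  have mg : measurable_fun setT g.
    by apply/measurable_EFinP; exact: measurable_funB.
  have : (\int[P]_w `|g w| = 0)%E.
    under eq_integral do rewrite gee0_abs// /g EFinB.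
    rewrite integralB_EFin//=; last 2 first.
    - exact: finite_measure_integrable_cst.
    - apply/integrableP; split; first exact/measurable_EFinP.
      under eq_integral => w _.
        rewrite gee0_abs; last by rewrite lee_fin expR_ge0.
        over.
      by rewrite E ltry.
    rewrite E integral_cst// mul1e.
    by rewrite [X in (X - _)%E](_ : _ = 1%E) ?subee//; exact: probability_setT.
  move=> /(ae_eq_integral_abs P measurableT mg); apply: negligibleS => w /=.
  move=> Zw H; apply: Zw; have := H Logic.I; rewrite /g => -[/subr0_eq].
  rewrite -expR0 => /expR_inj/esym/eqP.
  by rewrite oppr_eq0 mulf_eq0 gt_eqF//= => /eqP.
rewrite (ae_eq_integral (cst 1%E))//.
- by rewrite integral_cst// mul1e; exact: probability_setT.
- exact/measurable_EFinP.
- apply: (@negligibleS _ _ _ _ (~` [set w | Z w = 0])); last first.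
    by apply/negligibleP => //; exact: measurableC.
  move=> w /= H Zw; apply: H => _ /=.
  by rewrite Zw mulr0 oppr0 expR0.
Qed.

Lemma subordinator_exponent_eq0 (X : R -> T -> R) (psi : R -> R) t omega :
  subordinator P X psi -> 0 < t -> 0 < omega ->
  psi omega = 0 <-> P [set w | X t w = 0] = 1%E.
Proof.
move=> HX t0 o0; have t_ge0 := ltW t0.
rewrite -(expectation_expR_eq1 o0 (subordinator_measurable HX t_ge0));
  last first.
  by move=> w; exact: (subordinator_ge0 HX).
rewrite (subordinator_laplace HX t_ge0 o0); split=> [->|].
  by rewrite mulr0 oppr0 expR0.
move=> [/eqP]; rewrite -expR0 => /eqP/expR_inj/eqP.
by rewrite oppr_eq0 mulf_eq0 gt_eqF//= => /eqP.
Qed.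

End positivity.

Section exponent_sign.
Context (R : realType) (nu : {measure set R -> \bar R}) (psi : R -> R).
Hypothesis nupsi : driftless_exponent nu psi.

Let g omega (x : R) : \bar R := (1 - expR (- (omega * x)))%:E.

Let g_gt0 omega x : 0 < omega -> 0 < x -> (0 < g omega x)%E.
Proof.
by move=> o0 x0; rewrite lte_fin subr_gt0 expR_lt1 oppr_lt0 mulr_gt0.
Qed.

Let mg omega : measurable_fun setT (g omega).
Proof.
apply/measurable_EFinP; apply: measurable_funB => //.
apply: measurableT_comp => //; apply: measurable_funN.
by apply: measurable_funM.
Qed.

Lemma driftless_exponent_ge0 omega : 0 < omega -> 0 <= psi omega.
Proof.
move=> o0; rewrite -lee_fin (nupsi.2 _ o0); apply: integral_ge0 => x /=.
by rewrite in_itv/= andbT => x0; apply: ltW; exact: g_gt0.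
Qed.

(** The integrand in the Levy-Khintchine formula is positive, so a zero integral
    would force the measure to vanish. *)
Lemma driftless_exponent_gt0 omega : 0 < omega ->
  nu [set` `]0%R, +oo[] <> 0%E -> 0 < psi omega.
Proof.
move=> o0 nu0; rewrite lt_neqAle driftless_exponent_ge0// andbT.
apply/eqP => psi0; apply: nu0.
have mD : measurable (`]0%R, +oo[%classic : set R) by [].
have : (\int[nu]_(x in `]0%R, +oo[) `|g omega x| = (psi omega)%:E)%E.
  rewrite (nupsi.2 _ o0); apply: eq_integral => x.
  rewrite inE => xD; rewrite gee0_abs//; apply/ltW/g_gt0 => //.
  by move: xD; rewrite /= in_itv/= andbT.
rewrite -psi0 => /(ae_eq_integral_abs nu mD (measurable_funTS (mg omega))) H.
suff /(negligibleP nu mD) : nu.-negligible `]0%R, +oo[%classic by [].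
apply: negligibleS H => x /= x0 /(_ x0).
move: x0; rewrite in_itv/= andbT => x0 /eqP.
by rewrite gt_eqF// g_gt0.
Qed.

End exponent_sign.

(** A zero exponent would make [zeta], hence the clock at time 1, vanish almost
    surely. But the clock at 1 is at least the median of [X] times [L] at 1/2,
    so [L] would vanish almost surely at 1/2 and have exponent 0, which its
    infinite Levy measure excludes.

    The composition needs this sign: the exponents are constrained at positive
    frequencies only. *)
Lemma clock_exponent_gt0 d d' (T : measurableType d) (T' : measurableType d')
    (R : realType) (P : probability T R) (P' : probability T' R)
    (X : {RV P >-> R}) (L : T -> cumulative R R)
    (zeta : R -> T' -> R) (psi : R -> R) :
  clock_variable X ->
  infinite_activity_subordinator P (fun t w => L w t) ->
  subordinator P' zeta psi ->
  eq_in_law P P' (quantile_clock X L 1) (fun w => (zeta 1 w)%:E) ->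
  forall omega, 0 < omega -> 0 < psi omega.
Proof.
move=> hX [psiL [HL [nuL [nuLP nuLoo]]]] Hz [mC _ law] omega o0.
have [nu nuP] := subordinator_zero_drift Hz.
rewrite lt_neqAle (driftless_exponent_ge0 nuP)// andbT; apply/negP => /eqP psi0.
have psiL0 : 0 < psiL 1.
  by apply: (driftless_exponent_gt0 nuLP) => //; rewrite nuLoo.
have h0 : 0 < 2^-1 :> R by rewrite invr_gt0.
(* The contradiction is with the exponent of L at frequency 1. *)
suff PL : P [set w | L w 2^-1 = 0] = 1%E.
  have /(subordinator_exponent_eq0 HL h0 ltr01) E := PL.
  by rewrite E ltxx in psiL0.
have h_ge0 : 0 <= 2^-1 :> R by rewrite invr_ge0.
have mL0 : measurable [set w | L w 2^-1 = 0].
  have := subordinator_measurable HL h_ge0 measurableT (measurable_set1 0).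
  by rewrite setTI.
have PC : P [set w | quantile_clock X L 1 w = 0%E] = 1%E.
  have -> : [set w | quantile_clock X L 1 w = 0%E] =
    quantile_clock X L 1 @^-1` [set 0%E] by [].
  rewrite law; last exact: emeasurable_set1.
  rewrite (_ : _ @^-1` _ = [set w | zeta 1 w = 0]); last first.
    by apply/seteqP; split => w /= => [[]|->].
  by apply/(subordinator_exponent_eq0 Hz ltr01 o0).
apply/eqP; rewrite eq_le probability_le1//= -PC; apply: le_measure.
- by rewrite inE; have := mC measurableT _ (emeasurable_set1 0%E); rewrite setTI.
- by rewrite inE.
(* A positive value of L at 1/2 makes the clock at 1 positive. *)
move=> w /= C0; apply/eqP; rewrite eq_le.
have L0 : L w 0 = 0 by exact: (subordinator_start HL).
rewrite (subordinator_ge0 HL)// andbT leNgt; apply/negP => Lpos.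
have : (0 < quantile_clock X L 1 w)%E.
  apply: lt_le_trans (quantile_clock_lower_bound X L w h0 (_ : 2^-1 <= 1)).
    rewrite mule_gt0 ?L0 ?subr0 ?lte_fin//; apply: quantile_gt0 => //.
    by rewrite divr1 subr_gt0 invf_lt1// ltr1n.
  by rewrite invf_le1// ler1n.
by rewrite C0 ltxx.
Qed.

(** * Law of a composition of independent processes *)

Section path_measurable.
Context d (T : measurableType d) (R : realType).
Implicit Types (C D : set (set T)) (X Y : R -> T -> \bar R).

(** Joint measurability in time and outcome with respect to the information [C],
    which is what substituting a random time requires. *)
Definition path_measurable C X : Prop :=
  measurable_fun [set: \bar R * g_sigma_algebraType C]
    (fun z => at_etime X z.1 z.2).

Lemma path_measurableS C D X : C `<=` D ->
  path_measurable C X -> path_measurable D X.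
Proof.
move=> CD mX.
have mid : measurable_fun [set: g_sigma_algebraType D]
    (idfun : g_sigma_algebraType D -> g_sigma_algebraType C).
  apply: (measurable_fun_g_sigmaS CD).
  exact: (@measurable_id _ (g_sigma_algebraType C) setT).
have mid' : measurable_fun [set: \bar R * g_sigma_algebraType D]
    (fun z : \bar R * g_sigma_algebraType D => (z.2 : g_sigma_algebraType C)).
  exact: (measurableT_comp mid measurable_snd).
exact: measurableT_comp mX (measurable_fun_pair measurable_fst mid').
Qed.

Lemma path_measurableT C X : C `<=` measurable -> path_measurable C X ->
  measurable_fun [set: \bar R * T] (fun z => at_etime X z.1 z.2).
Proof.
move=> mC mX.
have mid := measurable_idfun_g_sigma mC.
have mid' : measurable_fun [set: \bar R * T]
    (fun z : \bar R * T => (z.2 : g_sigma_algebraType C)).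
  exact: (measurableT_comp mid measurable_snd).
exact: measurableT_comp mX (measurable_fun_pair measurable_fst mid').
Qed.

Lemma comp_eprocessE X Y t w : (0 <= Y t w)%E ->
  comp_eprocess X Y t w = at_etime X (Y t w) w.
Proof.
by rewrite /comp_eprocess /at_etime; case: (Y t w) => // r r0; rewrite max_r.
Qed.

Lemma comp_eprocess_ge0 X Y t w :
  (forall s, (0 <= s)%R -> 0 <= X s w)%E -> (0 <= Y t w)%E ->
  (0 <= comp_eprocess X Y t w)%E.
Proof.
move=> X0; rewrite /comp_eprocess; case: (Y t w) => [r r0|//|//]; exact: X0.
Qed.

Lemma comp_eprocess_increasing X Y :
  (forall t w, (0 <= t)%R -> 0 <= Y t w)%E ->
  increasing_process X -> increasing_process Y ->
  increasing_process (comp_eprocess X Y).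
Proof.
move=> Y0 Xi Yi w s t s0 st; have := Yi w s t s0 st.
have := Y0 s w s0; rewrite /comp_eprocess.
case: (Y s w) => [r r0|_|//]; case: (Y t w) => [r'| |] //=.
- by move=> rr'; apply: Xi.
- by move=> _; exact: leey.
Qed.

Lemma comp_eprocesses_ge0 n (X : 'I_n -> R -> T -> \bar R) t w : 0 <= t ->
  (forall i s, (0 <= s)%R -> 0 <= X i s w)%E -> (0 <= comp_eprocesses X t w)%E.
Proof.
rewrite /comp_eprocesses => t0; elim: n X => [|n IH] X X0.
  by rewrite big_ord0 lee_fin.
rewrite big_ord_recl; apply: comp_eprocess_ge0 => [s|]; first exact: X0.
by apply: (IH (fun i => X (lift ord0 i))) => i; exact: X0.
Qed.

Lemma comp_eprocesses_increasing n (X : 'I_n -> R -> T -> \bar R) :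
  (forall i t w, (0 <= t)%R -> 0 <= X i t w)%E ->
  (forall i, increasing_process (X i)) -> increasing_process (comp_eprocesses X).
Proof.
move=> X0 Xi; elim: n X X0 Xi => [|n IH] X X0 Xi.
  by move=> w s t _; rewrite /comp_eprocesses big_ord0.
rewrite /comp_eprocesses big_ord_recl; apply: comp_eprocess_increasing => //.
- by move=> t w t0; apply: comp_eprocesses_ge0 => // i s; exact: X0.
- by apply: (IH (fun i => X (lift ord0 i))) => // i; exact: X0.
Qed.

Lemma measurable_comp_eprocess C X Y t :
  path_measurable C X -> (forall w, 0 <= Y t w)%E ->
  measurable_fun [set: g_sigma_algebraType C] (Y t) ->
  measurable_fun [set: g_sigma_algebraType C] (comp_eprocess X Y t).
Proof.
move=> mX Y0 mY; rewrite (_ : comp_eprocess X Y t =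
  (fun w => at_etime X (Y t w) w)).
  exact: (measurableT_comp mX (measurable_fun_pair mY (@measurable_id _ _ _))).
by apply/funext => w; exact: comp_eprocessE.
Qed.

Lemma measurable_comp_eprocesses C n (X : 'I_n -> R -> T -> \bar R) t : 0 <= t ->
  (forall i s w, (0 <= s)%R -> 0 <= X i s w)%E ->
  (forall i, path_measurable C (X i)) ->
  measurable_fun [set: g_sigma_algebraType C] (comp_eprocesses X t).
Proof.
move=> t0; elim: n X => [|n IH] X X0 mX.
  by rewrite /comp_eprocesses big_ord0; exact: measurable_cst.
rewrite /comp_eprocesses big_ord_recl; apply: measurable_comp_eprocess => //.
- by move=> w; apply: comp_eprocesses_ge0 => // i s; exact: X0.
- by apply: (IH (fun i => X (lift ord0 i))) => // i; exact: X0.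
Qed.

Lemma comp_processes_EFin n (X : 'I_n -> R -> T -> R) t w :
  (comp_processes X t w)%:E = comp_eprocesses (fun i t w => (X i t w)%:E) t w.
Proof.
rewrite /comp_processes /comp_eprocesses.
elim: n X => [|n IH] X; first by rewrite !big_ord0.
by rewrite !big_ord_recl /comp_process {1}/comp_eprocess -IH.
Qed.

(** The freezing principle for [X] run at the independent time [Y t]. *)
Lemma probability_at_etime (P : probability T R) C1 C2 X Y t
    (B : set \bar R) : independent_pi_systems P C1 C2 -> measurable B ->
  path_measurable C2 X -> (forall w, 0 <= Y t w)%E ->
  measurable_fun [set: g_sigma_algebraType C1] (Y t) ->
  (P (comp_eprocess X Y t @^-1` B) =
    \int[P]_w P [set w' | B (at_etime X (Y t w) w')])%E.
Proof.
move=> CC mB mX Y0 mY.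
pose E := [set z : g_sigma_algebraType C1 * g_sigma_algebraType C2 |
  B (at_etime X (Y t z.1) z.2)].
have mE : measurable E.
  rewrite -[X in measurable X]setTI.
  have mp : measurable_fun setT ((fun z => (Y t z.1, z.2)) :
      g_sigma_algebraType C1 * g_sigma_algebraType C2 ->
      \bar R * g_sigma_algebraType C2).
    by apply: measurable_fun_pair => //; exact: measurableT_comp mY measurable_fst.
  exact: (measurableT_comp mX mp).
rewrite -(probability_diagonal CC mE); congr (P _).
by apply/seteqP; split => w /=; rewrite /E/= comp_eprocessE.
Qed.

End path_measurable.

Section composition_law.
Context d (T : measurableType d) d' (T' : measurableType d') (R : realType)
  (P : probability T R) (P' : probability T' R).

Lemma eq_in_law_cst d'' (V : measurableType d'') (v : V) :
  eq_in_law P P' (fun=> v) (fun=> v).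
Proof.
split; [exact: measurable_cst|exact: measurable_cst|move=> B mB].
by rewrite !preimage_cst; case: ifP => _; rewrite ?measure0// !probability_setT.
Qed.

(** After freezing, only the one-dimensional laws of [X] enter, as a function of
    the frozen time, and this function is then averaged over the law of [Y t].
    Both ingredients are the same for the two pairs; nothing is asked about the
    joint laws of [X] and [X'] at several times. *)
Lemma eq_in_law_comp_eprocess (C1 C2 : set (set T)) (C1' C2' : set (set T'))
    (X Y : R -> T -> \bar R) (X' Y' : R -> T' -> \bar R) t :
  independent_pi_systems P C1 C2 -> independent_pi_systems P' C1' C2' ->
  path_measurable C2 X -> path_measurable C2' X' ->
  (forall w, 0 <= Y t w)%E -> (forall w, 0 <= Y' t w)%E ->
  measurable_fun [set: g_sigma_algebraType C1] (Y t) ->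
  measurable_fun [set: g_sigma_algebraType C1'] (Y' t) ->
  (forall s, 0 <= s -> eq_in_law P P' (X s) (X' s)) ->
  eq_in_law P P' (Y t) (Y' t) ->
  eq_in_law P P' (comp_eprocess X Y t) (comp_eprocess X' Y' t).
Proof.
move=> CC CC' mX mX' Y0 Y0' mY mY' XX' YY'.
have mC2 := pi_system2_measurable CC; have mC2' := pi_system2_measurable CC'.
have mXT := path_measurableT mC2 mX; have mXT' := path_measurableT mC2' mX'.
have [mYT mYT' _] := YY'.
split.
- rewrite (_ : comp_eprocess X Y t = (fun w => at_etime X (Y t w) w)).
    exact: (measurableT_comp mXT
      (measurable_fun_pair mYT (@measurable_id _ _ _))).
  by apply/funext => w; exact: comp_eprocessE.
- rewrite (_ : comp_eprocess X' Y' t = (fun w => at_etime X' (Y' t w) w)).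
    exact: (measurableT_comp mXT'
      (measurable_fun_pair mYT' (@measurable_id _ _ _))).
  by apply/funext => w; exact: comp_eprocessE.
move=> B mB.
rewrite (probability_at_etime CC mB mX Y0 mY).
rewrite (probability_at_etime CC' mB mX' Y0' mY').
pose h y := P [set w | B (at_etime X y w)].
have hE y : h y = P' [set w | B (at_etime X' y w)].
  rewrite /h /at_etime; case: y => [r| |].
  - have r0 : 0 <= Num.max 0 r by rewrite le_max lexx.
    by have [_ _ E] := XX' _ r0; exact: E mB.
  - by have [_ _ E] := eq_in_law_cst (+oo%E : \bar R); exact: E mB.
  - by have [_ _ E] := eq_in_law_cst (+oo%E : \bar R); exact: E mB.
under [RHS]eq_integral do rewrite -hE.
apply: (eq_in_law_integral YY') => [|y]; last exact: measure_ge0.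
pose A := [set z : \bar R * T | B (at_etime X z.1 z.2)].
have mA : measurable A by rewrite -[X in measurable X]setTI; exact: mXT.
rewrite (_ : h = P \o xsection A); last first.
  apply/funext => y /=; congr (P _); apply/seteqP.
  by split => w /=; rewrite /xsection/= inE.
exact: measurable_fun_xsection.
Qed.

(** The driving processes [L] and [L'] only carry the independence: [X i] is
    determined by [L i], so the composition of the tail is measurable with respect
    to the joint events of the tail. *)
Lemma eq_in_law_comp_eprocesses n (L : 'I_n -> R -> T -> R)
    (L' : 'I_n -> R -> T' -> R) (X : 'I_n -> R -> T -> \bar R)
    (X' : 'I_n -> R -> T' -> \bar R) t : 0 <= t ->
  (forall i s, 0 <= s -> measurable_fun setT (L i s)) ->
  (forall i s, 0 <= s -> measurable_fun setT (L' i s)) ->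
  indep_processes P L -> indep_processes P' L' ->
  (forall i, path_measurable (process_sigma (L i)) (X i)) ->
  (forall i, path_measurable (process_sigma (L' i)) (X' i)) ->
  (forall i s w, (0 <= s)%R -> 0 <= X i s w)%E ->
  (forall i s w, (0 <= s)%R -> 0 <= X' i s w)%E ->
  (forall i s, 0 <= s -> eq_in_law P P' (X i s) (X' i s)) ->
  eq_in_law P P' (comp_eprocesses X t) (comp_eprocesses X' t).
Proof.
move=> t0; elim: n L L' X X' => [|n IH] L L' X X'.
  by rewrite /comp_eprocesses !big_ord0 => *; exact: eq_in_law_cst.
move=> mL mL' LI LI' mX mX' X0 X0' XX'.
rewrite /comp_eprocesses !big_ord_recl.
apply: (eq_in_law_comp_eprocess (independent_joint_events mL LI)
  (independent_joint_events mL' LI')) => //.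
- by move=> w; apply: comp_eprocesses_ge0 => // i s; exact: X0.
- by move=> w; apply: comp_eprocesses_ge0 => // i s; exact: X0'.
- apply: measurable_comp_eprocesses => // [i s w|i]; first exact: X0.
  by apply: path_measurableS (mX _); exact: process_sigma_joint_events.
- apply: measurable_comp_eprocesses => // [i s w|i]; first exact: X0'.
  by apply: path_measurableS (mX' _); exact: process_sigma_joint_events.
- by move=> s; exact: XX'.
apply: (IH (fun i => L (lift ord0 i)) (fun i => L' (lift ord0 i))) => //.
- by move=> i s; exact: mL.
- by move=> i s; exact: mL'.
- exact: indep_processes_tail.
- exact: indep_processes_tail.
- by move=> i s w; exact: X0.
- by move=> i s w; exact: X0'.
- by move=> i s; exact: XX'.
Qed.

End composition_law.

(** * Composition of clocks and of subordinators *)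

Section clock_measurable.
Context d (T : measurableType d) (R : realType) (P : probability T R).
Variables (X : {RV P >-> R}) (L : T -> cumulative R R).

Let C := process_sigma (fun t w => L w t).

Let measurable_quantile_clock t : 0 <= t ->
  measurable_fun [set: g_sigma_algebraType C] (quantile_clock X L t).
Proof.
rewrite le_eqVlt => /predU1P[<-|t0].
  rewrite (_ : quantile_clock X L 0 = cst 0%E); first exact: measurable_cst.
  by apply/funext => w; exact: quantile_clock0.
apply: (@measurable_stieltjes_integral _ (g_sigma_algebraType C) R L _ t) => //.
- by move=> s s0; exact: (@measurable_process_sigma _ _ _ (fun t w => L w t)).
- exact: ltW.
- exact: measurable_quantile_clock_integrand.
- by move=> s; exact: quantile_ge0.
Qed.

(** The clock inherits its randomness from [L] alone, so independence of the
    processes [L] can be used for the clocks. *)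
Lemma path_measurable_quantile_clock :
  path_measurable C (quantile_clock X L).
Proof.
have C_incr : increasing_process (quantile_clock X L).
  exact: quantile_clock_increasing.
apply: (left_continuous_measurable_at_etime measurable_quantile_clock C_incr).
by move=> w t c; exact: quantile_clock_left_continuous.
Qed.

End clock_measurable.

Lemma path_measurable_subordinator d (T : measurableType d) (R : realType)
    (P : probability T R) (X : R -> T -> R) (psi : R -> R) :
  subordinator P X psi ->
  path_measurable (process_sigma X) (fun t w => (X t w)%:E).
Proof.
move=> HX; apply: right_continuous_measurable_at_etime_EFin.
- by move=> t; exact: measurable_process_sigma.
- exact: (subordinator_increasing HX).
- exact: (subordinator_right_continuous HX).
Qed.

Lemma comp_processesS (R : realType) (T : Type) n
    (X : 'I_n.+1 -> R -> T -> R) :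
  comp_processes X =
  comp_process (X ord0) (comp_processes (fun i => X (lift ord0 i))).
Proof. by rewrite /comp_processes big_ord_recl. Qed.

Lemma comp_exponentsS (R : realType) n (psi : 'I_n.+1 -> R -> R) :
  comp_exponents psi = comp_exponents (fun i => psi (lift ord0 i)) \o psi ord0.
Proof. by rewrite /comp_exponents big_ord_recl. Qed.

(** For no process the composition is the identity, a pure drift, so the
    induction starts at one process. *)
Lemma subordinator_comp_processes d (T : measurableType d) (R : realType)
    (P : probability T R) k (zeta : 'I_k -> R -> T -> R)
    (psi : 'I_k -> R -> R) : (0 < k)%N ->
  (forall i, subordinator P (zeta i) (psi i)) -> indep_processes P zeta ->
  (forall i omega, 0 < omega -> 0 < psi i omega) ->
  subordinator P (comp_processes zeta) (comp_exponents psi).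
Proof.
case: k zeta psi => // n zeta psi _.
elim: n => [|n IH] in zeta psi *.
  move=> Hz _ _; rewrite /comp_processes /comp_exponents !big_ord_recl !big_ord0.
  exact: Hz.
move=> Hz zI psi_gt0.
rewrite comp_processesS comp_exponentsS.
have mz i t : 0 <= t -> measurable_fun setT (zeta i t).
  exact: (subordinator_measurable (Hz i)).
have CC := independent_joint_events mz zI.
have IHz : subordinator P (comp_processes (fun i => zeta (lift ord0 i)))
    (comp_exponents (fun i => psi (lift ord0 i))).
  apply: IH => [i||i]; [exact: Hz| |exact: psi_gt0].
  exact: (indep_processes_tail zI).
apply: (subordinator_comp CC (Hz ord0) IHz).
- by move=> t; exact: measurable_process_sigma.
- move=> t t0; apply/measurable_EFinP.
  rewrite (_ : _ \o _ = comp_eprocesses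
    (fun i t w => (zeta (lift ord0 i) t w)%:E) t).
    apply: measurable_comp_eprocesses => // [i s w s0|i].
      by rewrite lee_fin; exact: (subordinator_ge0 (Hz _)).
    apply: path_measurableS (path_measurable_subordinator (Hz _)).
    exact: (@process_sigma_joint_events _ _ _ _ (fun i => zeta (lift ord0 i))).
  apply/funext => w.
  exact: (comp_processes_EFin (fun i => zeta (lift ord0 i))).
- exact: psi_gt0.
Qed.

Section continuity.
Context d (T : measurableType d) (R : realType) (P : probability T R).

(** Finiteness is part of the induction: a finite inner value is a genuine time,
    at which continuity of the outer process applies. *)
Let comp_continuous_finite n (X : 'I_n -> R -> T -> \bar R) w :
  (forall i s, (0 <= s)%R -> 0 <= X i s w)%E ->
  (forall i s, 0 <= s -> X i s w \is a fin_num) ->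
  (forall i, {within `[0, +oo[, continuous (X i ^~ w)}) ->
  {within `[0, +oo[, continuous (comp_eprocesses X ^~ w)} /\
  (forall s, 0 <= s -> comp_eprocesses X s w \is a fin_num).
Proof.
rewrite /comp_eprocesses; elim: n X => [|n IH] X X0 Xfin Xc.
  rewrite big_ord0; split => //; apply/continuous_subspaceT => s.
  exact: cvg_comp.
rewrite big_ord_recl.
have [] := IH (fun i => X (lift ord0 i))
  (fun i => X0 _) (fun i => Xfin _) (fun i => Xc _).
have : forall s, 0 <= s ->
    (0%R <= comp_eprocesses (fun i => X (lift ord0 i)) s w)%E.
  by move=> s s0; apply: comp_eprocesses_ge0 => // i r; exact: X0.
rewrite /comp_eprocesses; set Y := \big[_/_]_(i < n) _.
move=> Y0 Yc Yfin.
have yfin s : 0 <= s -> Y s w = (fine (Y s w))%:E.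
  by move=> s0; rewrite fineK// Yfin.
have y0 s : 0 <= s -> 0 <= fine (Y s w) by move=> s0; rewrite fine_ge0// Y0.
have XYE s : 0 <= s -> comp_eprocess (X ord0) Y s w = X ord0 (fine (Y s w)) w.
  by move=> s0; rewrite /comp_eprocess yfin.
split=> [|s s0]; last by rewrite XYE// Xfin// y0.
apply/subspace_continuousP => t /=; rewrite in_itv/= andbT => t0.
rewrite [X in _ --> X](_ : _ = X ord0 (fine (Y t w)) w); last exact: XYE.
(* Near t, within nonnegative times, the composition is X at a real time. *)
have A_near : \forall s \near within `[0, +oo[%classic (nbhs t), 0 <= s.
  by rewrite near_withinE; apply: nearW => s /=; rewrite in_itv/= andbT.
apply: cvg_trans.
  apply: near_eq_cvg; near=> s; symmetry; apply: XYE; near: s; exact: A_near.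
have ycvg :
    fine (Y s w) @[s --> within `[0, +oo[%classic (nbhs t)] --> fine (Y t w).
  apply: fine_cvg; rewrite -yfin//.
  by move/subspace_continuousP : Yc; apply; rewrite /= in_itv/= andbT.
have ycvgA : fine (Y s w) @[s --> within `[0, +oo[%classic (nbhs t)] -->
    within `[0, +oo[%classic (nbhs (fine (Y t w))).
  move=> U /ycvg; apply: filterS2 A_near => s s0.
  by apply; rewrite /= in_itv/= andbT y0.
have /subspace_continuousP/(_ (fine (Y t w))) := Xc ord0.
rewrite /= in_itv/= andbT y0// => /(_ isT) Xcvg.
exact: cvg_comp ycvgA Xcvg.
Unshelve. all: by end_near. Qed.

(** By monotonicity, finiteness at the integers gives finiteness at all times,
    so that countably many null sets are discarded. *)
Lemma continuous_comp_eprocesses n (X : 'I_n -> R -> T -> \bar R) :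
  (forall i s w, (0 <= s)%R -> 0 <= X i s w)%E ->
  (forall i, increasing_process (X i)) ->
  (forall i s, 0 <= s -> {ae P, forall w, X i s w \is a fin_num}) ->
  (forall i, continuous_process P (X i)) ->
  continuous_process P (comp_eprocesses X).
Proof.
move=> X0 Xi Xfin Xc.
have Xfin' : {ae P, forall w, forall i (m : nat), X i m%:R w \is a fin_num}.
  by apply: filter_forall => i; apply: ae_foralln => m; exact: Xfin.
have Xc' : {ae P, forall w, forall i, {within `[0, +oo[, continuous (X i ^~ w)}}.
  by apply: filter_forall => i; exact: Xc.
apply: filterS2 Xfin' Xc' => w wfin wc.
have [] := @comp_continuous_finite n X w _ _ wc => //.
- by move=> i s; exact: X0.
- move=> i s s0; rewrite ge0_fin_numE ?X0//.
  apply: (@le_lt_trans _ _ (X i (Num.truncn s).+1%:R w)).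
    by apply: Xi => //; apply/ltW/truncnS_gt.
  by rewrite -ge0_fin_numE ?wfin// X0.
Qed.

End continuity.

(** The set of nonfinite values has the same probability for both variables. *)
Lemma eq_in_law_fin_num d d' (T : measurableType d) (T' : measurableType d')
    (R : realType) (P : probability T R) (P' : probability T' R)
    (X : T -> \bar R) (Y : T' -> R) :
  eq_in_law P P' X (fun w => (Y w)%:E) -> {ae P, forall w, X w \is a fin_num}.
Proof.
move=> [mX _ XY].
have mfin : measurable [set y : \bar R | y \is a fin_num].
  by rewrite -[X in measurable X]setTI; apply: emeasurable_fin_num.
exists (X @^-1` (~` [set y | y \is a fin_num])); split => //.
- by rewrite -[X in measurable X]setTI; apply: mX => //; exact: measurableC.
- rewrite XY; last exact: measurableC.
  rewrite (_ : _ @^-1` _ = set0) ?measure0//.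
  by apply/seteqP; split => w //= /(_ isT).
Qed.

Theorem proposition7p1 (R : realType)
    (d : measure_display) (T : measurableType d) (P : probability T R)
    (d' : measure_display) (T' : measurableType d') (P' : probability T' R)
    (k : nat) (k_gt0 : (0 < k)%N)
    (Rv : 'I_k -> {RV P >-> R}) (L : 'I_k -> T -> cumulative R R)
    (zeta : 'I_k -> R -> T' -> R) (psi : 'I_k -> R -> R)
    (hR : forall i, clock_variable (Rv i))
    (hL : forall i, infinite_activity_subordinator P (fun t w => L i w t))
    (indepL : indep_processes P (fun i t w => L i w t))
    (hzeta : forall i, subordinator P' (zeta i) (psi i))
    (indep_zeta : indep_processes P' zeta)
    (hlaw : forall i t, 0 <= t ->
      eq_in_law P P' (quantile_clock (Rv i) (L i) t)
        (fun w => (zeta i t w)%:E)) :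
  let That := comp_eprocesses (fun i => quantile_clock (Rv i) (L i)) in
  let zetahat := comp_processes zeta in
  [/\ increasing_process That,
      forall t, 0 <= t ->
        eq_in_law P P' (That t) (fun w => (zetahat t w)%:E),
      subordinator P' zetahat (comp_exponents psi) &
      (forall i, continuous_process P (quantile_clock (Rv i) (L i))) ->
      continuous_process P That].
Proof.
move=> That zetahat.
have C0 i s w : 0 <= s -> (0 <= quantile_clock (Rv i) (L i) s w)%E.
  by move=> _; exact: quantile_clock_ge0.
have Ci i : increasing_process (quantile_clock (Rv i) (L i)).
  exact: quantile_clock_increasing.
have mL i s : 0 <= s -> measurable_fun setT (fun w => L i w s).
  by have [psiL [HL _]] := hL i; exact: (subordinator_measurable HL).
split.
- exact: comp_eprocesses_increasing.
- move=> t t0.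
  rewrite (_ : (fun w => (zetahat t w)%:E) =
    comp_eprocesses (fun i t w => (zeta i t w)%:E) t); last first.
    by apply/funext => w; exact: comp_processes_EFin.
  apply: (eq_in_law_comp_eprocesses t0 mL _ indepL indep_zeta) => //.
  + by move=> i s; exact: (subordinator_measurable (hzeta i)).
  + by move=> i; exact: path_measurable_quantile_clock.
  + by move=> i; exact: path_measurable_subordinator (hzeta i).
  + by move=> i s w s0; rewrite lee_fin; exact: (subordinator_ge0 (hzeta i)).
- have psi_gt0 i omega : 0 < omega -> 0 < psi i omega.
    exact: (clock_exponent_gt0 (hR i) (hL i) (hzeta i) (hlaw i 1 ler01)).
  exact: subordinator_comp_processes.
- apply: continuous_comp_eprocesses => // i s s0.
  exact: eq_in_law_fin_num (hlaw i s s0).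
Qed.
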